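(* Let $K$ be an algebraically closed field of characteristic $p\ge 0$, let $C\subset\mathbb{P}^2$ be an irreducible plane curve over $K$ of degree $d\ge 4$, and let $P\in\mathbb{P}^2$. If $p=0$ or $p$ does not divide the order $|G_0[P]|$, then the group $G_0[P]$ is a cyclic group. Furthermore, (under the same assumption on $p$) for an integer $n\ge 2$, $n$ divides $|G_0[P]|$ if and only if there exists a linear transformation $\phi$ of $\mathbb{P}^2$ such that (1) $\phi(P)=(1:0:0)$, (2) there exists an element $\sigma\in G_0[\phi(P)]\subset \mathrm{Bir}(\phi(C))$ (the group $G_0[\phi(P)]$ being taken with respect to the curve $\phi(C)$) which is represented by the matrix $$A_\sigma=\left(\begin{array}{ccc}\zeta&0&0\\0&1&0\\0&0&1\end{array}\right),$$ where $\zeta$ is a primitive $n$-th root of unity, and (3) $\phi(C)$ is given by $$\sum_i G_{d-ni}(Y,Z)X^{ni}=0,$$ where $G_{d-ni}$ is a homogeneous polynomial of degree $d-ni$ in the variables $Y,Z$.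
   Context: Homogeneous coordinates on $\mathbb{P}^2$ are $(X:Y:Z)$. $\mathrm{Bir}(C)$ is the group of birational transformations of $C$. For $P\in\mathbb{P}^2$, $\pi_P:C\dashrightarrow\mathbb{P}^1$ is the projection from $P$, $Q\mapsto\overline{PQ}$. Define $G[P]=\{\tau\in\mathrm{Bir}(C)\mid \tau(C\cap\ell\setminus\{P\})\subset\ell \text{ for a general line } \ell\ni P\}=\{\tau\in\mathrm{Bir}(C)\mid \pi_P\circ\tau=\pi_P\}$; it is a finite subgroup of $\mathrm{Bir}(C)$ whose order divides $\deg\pi_P$. $G_0[P]\subset G[P]$ is the subgroup of all elements of $G[P]$ which are restrictions to $C$ of linear transformations (projective linear automorphisms) of $\mathbb{P}^2$. A linear transformation is represented by a $3\times 3$ matrix $A$ if it is $(X:Y:Z)\mapsto (X:Y:Z)\,{}^tA$. *)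

(* Defs.v *)
From HB Require Import structures.
From mathcomp Require Import all_boot all_order all_algebra.
From mathcomp Require Import finmap.
From mathcomp Require Import boolp classical_sets cardinality.
From mathcomp Require Import mpoly.

Set Implicit Arguments.
Unset Strict Implicit.
Unset Printing Implicit Defensive.

Import GRing.Theory.

Local Open Scope ring_scope.
Local Open Scope classical_set_scope.
Local Open Scope quotient_scope.

(* A plane curve F = 0 is represented by its form F in K[X, Y, Z], with       *)
(* 'X_0 = X, 'X_1 = Y, 'X_2 = Z; a point (a : b : c) of P^2 by a nonzero row  *)
(* vector; a rational map C --> P^2 by a triple of forms of one degree.       *)

Definition irreducible_mpoly (K : fieldType) (n : nat) (F : {mpoly K[n]}) :=
  [/\ F != 0, F \isn't a GRing.unit
    & forall A B : {mpoly K[n]}, F = A * B ->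
        A \is a GRing.unit \/ B \is a GRing.unit].

Section RationalMaps.
Variables (K : fieldType) (F : {mpoly K[3]}).

Notation triple := (3.-tuple {mpoly K[3]}).

Definition dvdF (u : {mpoly K[3]}) := exists v, u = v * F.

Definition homog_triple (f : triple) :=
  exists e : nat, forall i, tnth f i \is e.-homog.

(* Forms that are not zero divisors in K[X, Y, Z] / (F).  When F is           *)
(* irreducible these are exactly the forms not divisible by F, i.e. the forms *)
(* which do not vanish identically on C.                                      *)
Definition nonzerodiv (a : {mpoly K[3]}) :=
  (exists e : nat, a \is e.-homog) /\
  (forall (u : {mpoly K[3]}) (e : nat), u \is e.-homog ->
     dvdF (a * u) -> dvdF u).

(* Equality of rational maps on C: f and g are proportional on C, the factor  *)
(* being a nonzero rational function b / a.                                   *)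
Definition ratmap_eq (f g : triple) :=
  exists a b, [/\ nonzerodiv a, nonzerodiv b
    & forall i, dvdF (a * tnth f i - b * tnth g i)].

Definition ratmap_comp (f g : triple) : triple :=
  [tuple tnth f i \mPo g | i < 3].

Definition ratmap_id : triple := [tuple 'X_i | i < 3].

(* A rational map from C to C.  The condition that f does not vanish          *)
(* identically on C is left out: in [birational] it follows from the          *)
(* existence of an inverse.                                                   *)
Definition self_map (f : triple) := homog_triple f /\ dvdF (F \mPo f).

Definition birational (f : triple) :=
  self_map f /\
  exists g, [/\ self_map g, ratmap_eq (ratmap_comp g f) ratmap_id
              & ratmap_eq (ratmap_comp f g) ratmap_id].

Lemma dvdF0 : dvdF 0. Proof. by exists 0; rewrite mul0r. Qed.

Lemma dvdFD u v : dvdF u -> dvdF v -> dvdF (u + v).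
Proof. by move=> [x ->] [y ->]; exists (x + y); rewrite mulrDl. Qed.

Lemma dvdFM u v : dvdF v -> dvdF (u * v).
Proof. by move=> [x ->]; exists (u * x); rewrite mulrA. Qed.

Lemma dvdFN u : dvdF u -> dvdF (- u).
Proof. by move=> [x ->]; exists (- x); rewrite mulNr. Qed.

Lemma dvdFB u v : dvdF (u - v) -> dvdF v -> dvdF u.
Proof. by move=> uv v0; rewrite -(subrK v u); apply: dvdFD. Qed.

Lemma dvdFC u v : dvdF (u - v) -> dvdF (v - u).
Proof. by move=> /dvdFN; rewrite opprB. Qed.

Lemma dvdF_trans v u w : dvdF (u - v) -> dvdF (v - w) -> dvdF (u - w).
Proof. by move=> uv vw; rewrite -(subrKA v u); apply: dvdFD. Qed.

Lemma dvdF_mul2 u u' v v' :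
  dvdF (u - u') -> dvdF (v - v') -> dvdF (u * v - u' * v').
Proof.
move=> uu vv; apply: (@dvdF_trans (u * v')).
  by rewrite -mulrBr; apply: dvdFM.
by rewrite -mulrBl mulrC; apply: dvdFM.
Qed.

Lemma dvdF_exp u v k : dvdF (u - v) -> dvdF (u ^+ k - v ^+ k).
Proof.
move=> uv; elim: k => [|k IHk]; first by rewrite !expr0 subrr; apply: dvdF0.
by rewrite !exprS; apply: dvdF_mul2.
Qed.

Lemma dvdF_comp u f : dvdF (F \mPo f) -> dvdF u -> dvdF (u \mPo f).
Proof. by move=> Ff [v ->]; rewrite rmorphM /=; apply: dvdFM. Qed.

Lemma nonzerodiv1 : nonzerodiv 1.
Proof.
split; first by exists 0%N; apply: dhomog1.
by move=> u e _; rewrite mul1r.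
Qed.

Lemma nonzerodivM a b : nonzerodiv a -> nonzerodiv b -> nonzerodiv (a * b).
Proof.
move=> [[da ha] ra] [[db hb] rb]; split.
  by exists (da + db)%N; apply: dhomogM.
move=> u e hu; rewrite -mulrA => /(ra _ (db + e)%N).
by move=> H; apply: (rb _ e hu); apply: H; apply: dhomogM.
Qed.

Lemma nonzerodivX a k : nonzerodiv a -> nonzerodiv (a ^+ k).
Proof.
move=> ra; elim: k => [|k IHk]; first exact: nonzerodiv1.
by rewrite exprS; apply: nonzerodivM.
Qed.

Lemma comp_tuple_mpoly n (h : 3.-tuple {mpoly K[n]}) (u : {mpoly K[3]})
    (f : triple) :
  (u \mPo f) \mPo h = u \mPo [tuple tnth f i \mPo h | i < 3].
Proof.
rewrite (comp_mpolyE u f) (comp_mpolyE u [tuple tnth f i \mPo h | i < 3]) raddf_sum /=.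
apply: eq_bigr => m _; rewrite comp_mpolyZ rmorph_prod /=; congr (_ *: _).
by apply: eq_bigr => i _; rewrite rmorphXn /= tnth_mktuple.
Qed.

Lemma homog_comp u k (f : triple) e :
  u \is k.-homog -> (forall i, tnth f i \is e.-homog) ->
  u \mPo f \is (e * k).-homog.
Proof.
move=> hu hf; rewrite comp_mpolyE big_seq.
apply: rpred_sum => m mu; apply: rpredZ.
have <- : mdeg m = k by move/dhomogP: hu => /(_ m mu).
rewrite mdegE big_distrr /=.
elim/big_rec2: _ => [|i d q _ hq]; first exact: dhomog1.
by apply: dhomogM => //; apply: dhomogMn.
Qed.

Lemma homog_scale_comp u k (f g : triple) a :
  u \is k.-homog -> (forall i, tnth g i = a * tnth f i) ->
  u \mPo g = a ^+ k * (u \mPo f).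
Proof.
move=> hu hg; rewrite !comp_mpolyE mulr_sumr; apply: eq_big_seq => m mu.
rewrite -scalerAr; congr (_ *: _).
have <- : mdeg m = k by move/dhomogP: hu => /(_ m mu).
rewrite mdegE -prodrXr -big_split /=.
by apply: eq_bigr => i _; rewrite hg exprMn.
Qed.

Lemma cong_comp u (f g : triple) :
  (forall i, dvdF (tnth f i - tnth g i)) -> dvdF ((u \mPo f) - (u \mPo g)).
Proof.
move=> fg; rewrite !comp_mpolyE -sumrB.
elim/big_rec: _ => [|m v _]; first exact: dvdF0.
apply: dvdFD; rewrite -scalerBr -mul_mpolyC; apply: dvdFM.
elim/big_rec2: _ => [|i p q _ pq]; first by rewrite subrr; apply: dvdF0.
by apply: dvdF_mul2 => //; apply: dvdF_exp.
Qed.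

Lemma prop_comp u k (f g : triple) a b : u \is k.-homog ->
  (forall i, dvdF (a * tnth f i - b * tnth g i)) ->
  dvdF (a ^+ k * (u \mPo f) - b ^+ k * (u \mPo g)).
Proof.
move=> hu fg.
rewrite -(@homog_scale_comp _ _ f [tuple a * tnth f i | i < 3] _ hu); last first.
  by move=> i; rewrite tnth_mktuple.
rewrite -(@homog_scale_comp _ _ g [tuple b * tnth g i | i < 3] _ hu); last first.
  by move=> i; rewrite tnth_mktuple.
by apply: cong_comp => i; rewrite !tnth_mktuple.
Qed.

Lemma ratmap_eq_refl f : ratmap_eq f f.
Proof.
exists 1, 1; split; [exact: nonzerodiv1 | exact: nonzerodiv1 |].
by move=> i; rewrite subrr; apply: dvdF0.
Qed.

Lemma ratmap_eq_sym f g : ratmap_eq f g -> ratmap_eq g f.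
Proof. by move=> [a [b [ra rb fg]]]; exists b, a; split=> // i; apply: dvdFC. Qed.

Lemma ratmap_eq_trans g f h : ratmap_eq f g -> ratmap_eq g h -> ratmap_eq f h.
Proof.
move=> [a [b [ra rb fg]]] [c [e [rc re gh]]].
exists (c * a), (b * e); split; [exact: nonzerodivM | exact: nonzerodivM |].
move=> i; apply: (@dvdF_trans (b * (c * tnth g i))).
  rewrite [X in _ - X]mulrCA -mulrA -mulrBr; exact: dvdFM.
by rewrite -[b * e * _]mulrA -mulrBr; apply: dvdFM.
Qed.

Lemma ratmap_compA f g h :
  ratmap_comp f (ratmap_comp g h) = ratmap_comp (ratmap_comp f g) h.
Proof.
apply: eq_from_tnth => i.
by rewrite !tnth_mktuple comp_tuple_mpoly.
Qed.

Lemma ratmap_comp1f f : ratmap_comp ratmap_id f = f.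
Proof.
by apply: eq_from_tnth => i; rewrite !tnth_mktuple comp_mpolyXU (tnth_nth 0).
Qed.

Lemma ratmap_compf1 f : ratmap_comp f ratmap_id = f.
Proof. by apply: eq_from_tnth => i; rewrite tnth_mktuple comp_mpoly_id. Qed.

Lemma self_map_id : self_map ratmap_id.
Proof.
split; last by rewrite comp_mpoly_id; exists 1; rewrite mul1r.
by exists 1%N => i; rewrite tnth_mktuple dhomogX /= mdeg1.
Qed.

Lemma self_map_comp f g : self_map f -> self_map g -> self_map (ratmap_comp f g).
Proof.
move=> [[d hf] Ff] [[e hg] Fg]; split.
  by exists (e * d)%N => i; rewrite tnth_mktuple; apply: homog_comp.
by rewrite -comp_tuple_mpoly; apply: dvdF_comp.
Qed.

Lemma nonzerodiv_comp a f : birational f -> nonzerodiv a -> nonzerodiv (a \mPo f).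
Proof.
move=> [[[df hf] Ff] [g [[[dg hg] Fg] gf fg]]] [[n ha] ra]; split.
  by exists (df * n)%N; apply: homog_comp.
move=> u k hu /(dvdF_comp Fg); rewrite rmorphM /= comp_tuple_mpoly => H.
have ug : dvdF (u \mPo g).
  have [c [e [rc re E]]] := fg.
  have [_ reg] := nonzerodivM (nonzerodivX n re) (conj (ex_intro _ n ha) ra).
  apply: (reg _ (dg * k)%N); first exact: homog_comp.
  have {}E := prop_comp ha E; rewrite comp_mpoly_id in E.
  apply: dvdFB (dvdFM (c ^+ n) H); rewrite [c ^+ n * _]mulrA -mulrBl mulrC.
  by apply: dvdFM; apply: dvdFC.
have [c [e [rc re E]]] := gf.
have [_ reg] := nonzerodivX k re; apply: (reg _ _ hu).
have {}E := prop_comp hu E; rewrite comp_mpoly_id in E.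
apply: dvdFB (dvdFC E) (dvdFM _ _).
by rewrite -comp_tuple_mpoly; apply: dvdF_comp.
Qed.

Lemma ratmap_comp_eql f g g' : homog_triple f ->
  ratmap_eq g g' -> ratmap_eq (ratmap_comp f g) (ratmap_comp f g').
Proof.
move=> [d hf] [a [b [ra rb E]]]; exists (a ^+ d), (b ^+ d).
split; [exact: nonzerodivX | exact: nonzerodivX |].
by move=> i; rewrite !tnth_mktuple; apply: prop_comp.
Qed.

Lemma ratmap_comp_eqr f f' g : birational g ->
  ratmap_eq f f' -> ratmap_eq (ratmap_comp f g) (ratmap_comp f' g).
Proof.
move=> bg [a [b [ra rb E]]]; exists (a \mPo g), (b \mPo g).
split; [exact: nonzerodiv_comp | exact: nonzerodiv_comp |].
move=> i; rewrite !tnth_mktuple -!rmorphM -rmorphB /=.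
by apply: dvdF_comp => //; case: bg => [[]].
Qed.

Lemma birational_id : birational ratmap_id.
Proof.
split; first exact: self_map_id.
exists ratmap_id; rewrite ratmap_compf1.
by split; [exact: self_map_id | exact: ratmap_eq_refl | exact: ratmap_eq_refl].
Qed.

Lemma birational_inv f g : self_map f -> self_map g ->
  ratmap_eq (ratmap_comp g f) ratmap_id ->
  ratmap_eq (ratmap_comp f g) ratmap_id -> birational g.
Proof. by move=> mf mg gf fg; split=> //; exists f. Qed.

Lemma birational_comp f g :
  birational f -> birational g -> birational (ratmap_comp f g).
Proof.
move=> bf bg; have [mf [f' [mf' f'f ff']]] := bf.
have [mg [g' [mg' g'g gg']]] := bg.
have bf' := birational_inv mf mf' f'f ff'.
have bg' := birational_inv mg mg' g'g gg'.
split; first exact: self_map_comp.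
exists (ratmap_comp g' f'); split; first exact: self_map_comp.
  rewrite -ratmap_compA [ratmap_comp f' _]ratmap_compA.
  apply: (ratmap_eq_trans _ g'g); apply: ratmap_comp_eql; first by case: mg'.
  by rewrite -[g in ratmap_eq _ g]ratmap_comp1f; apply: ratmap_comp_eqr.
rewrite -ratmap_compA [ratmap_comp g _]ratmap_compA.
apply: (ratmap_eq_trans _ ff'); apply: ratmap_comp_eql; first by case: mf.
by rewrite -[f' in ratmap_eq _ f']ratmap_comp1f; apply: ratmap_comp_eqr.
Qed.

Record bir_rep := BirRep { bir_map :> triple; bir_mapP : `[< birational bir_map >] }.
HB.instance Definition _ := [isSub for bir_map].
HB.instance Definition _ := [Choice of bir_rep by <:].

Definition bir_equiv (f g : bir_rep) : bool := `[< ratmap_eq f g >].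

Lemma bir_equiv_refl : reflexive bir_equiv.
Proof. by move=> f; apply/asboolP; apply: ratmap_eq_refl. Qed.

Lemma bir_equiv_sym : ssrbool.symmetric bir_equiv.
Proof. by move=> f g; apply/asboolP/asboolP; apply: ratmap_eq_sym. Qed.

Lemma bir_equiv_trans : transitive bir_equiv.
Proof.
by move=> g f h /asboolP fg /asboolP gh; apply/asboolP; apply: ratmap_eq_trans gh.
Qed.

Canonical bir_equivalence :=
  EquivRel bir_equiv bir_equiv_refl bir_equiv_sym bir_equiv_trans.

(* Bir(C), with composition as group law. *)
Definition Bir := {eq_quot bir_equiv}.
HB.instance Definition _ := Choice.on Bir.

Definition bir_triple (t : Bir) : triple := bir_map (repr t).

Definition bir_class (f : triple) (bf : birational f) : Bir :=
  \pi_Bir (BirRep (asboolT bf)).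

Lemma bir_tripleP t : birational (bir_triple t).
Proof. exact: asboolW (bir_mapP (repr t)). Qed.

Lemma bir_class_triple f (bf : birational f) :
  ratmap_eq (bir_triple (bir_class bf)) f.
Proof.
rewrite /bir_triple /bir_class.
have /eqquotP/asboolP : repr (\pi_Bir (BirRep (asboolT bf))) =
   BirRep (asboolT bf) %[mod Bir] by rewrite reprK.
by [].
Qed.

Lemma bir_eqP (s t : Bir) : ratmap_eq (bir_triple s) (bir_triple t) -> s = t.
Proof.
move=> E; rewrite -[s]reprK -[t]reprK; apply/eqquotP; exact/asboolP.
Qed.

Definition bir_one : Bir := bir_class birational_id.

Definition bir_mul (s t : Bir) : Bir :=
  bir_class (birational_comp (bir_tripleP s) (bir_tripleP t)).

Lemma bir_inv_subproof (t : Bir) : exists g, birational g /\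
  ratmap_eq (ratmap_comp g (bir_triple t)) ratmap_id.
Proof.
have [mf [g [mg gf fg]]] := bir_tripleP t.
by exists g; split => //; apply: birational_inv fg.
Qed.

Definition bir_inv (t : Bir) : Bir :=
  bir_class (projT2 (cid (bir_inv_subproof t))).1.

Lemma bir_mul_triple s t : ratmap_eq (bir_triple (bir_mul s t))
  (ratmap_comp (bir_triple s) (bir_triple t)).
Proof. exact: bir_class_triple. Qed.

Lemma homog_bir t : homog_triple (bir_triple t).
Proof. by have [[]] := bir_tripleP t. Qed.

Lemma bir_mulA : associative bir_mul.
Proof.
move=> r s t; apply: bir_eqP.
apply: (ratmap_eq_trans (bir_mul_triple _ _)).
apply: ratmap_eq_trans (ratmap_eq_sym (bir_mul_triple _ _)).
apply: ratmap_eq_trans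
  (ratmap_comp_eql (homog_bir r) (bir_mul_triple s t)) _.
rewrite ratmap_compA; apply: ratmap_comp_eqr; first exact: bir_tripleP.
exact/ratmap_eq_sym/bir_mul_triple.
Qed.

Lemma bir_mul1 : left_id bir_one bir_mul.
Proof.
move=> t; apply: bir_eqP; apply: (ratmap_eq_trans (bir_mul_triple _ _)).
rewrite -[X in ratmap_eq _ X]ratmap_comp1f.
by apply: ratmap_comp_eqr; [exact: bir_tripleP | exact: bir_class_triple].
Qed.

Lemma bir_mulr1 : right_id bir_one bir_mul.
Proof.
move=> t; apply: bir_eqP; apply: (ratmap_eq_trans (bir_mul_triple _ _)).
rewrite -[X in ratmap_eq _ X]ratmap_compf1.
by apply: ratmap_comp_eql; [exact: homog_bir | exact: bir_class_triple].
Qed.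

Lemma bir_mulV : left_inverse bir_one bir_inv bir_mul.
Proof.
move=> t; apply: bir_eqP; apply: (ratmap_eq_trans (bir_mul_triple _ _)).
apply: ratmap_eq_trans (ratmap_eq_sym (bir_class_triple _)).
have [_ gt] := projT2 (cid (bir_inv_subproof t)).
apply: ratmap_eq_trans gt; apply: ratmap_comp_eqr; first exact: bir_tripleP.
exact: bir_class_triple.
Qed.

Lemma bir_mulrV : right_inverse bir_one bir_inv bir_mul.
Proof.
move=> t; rewrite -[LHS]bir_mul1 -{1}(bir_mulV (bir_inv t)) -bir_mulA.
by rewrite [bir_mul (bir_inv t) _]bir_mulA bir_mulV bir_mul1 bir_mulV.
Qed.

HB.instance Definition _ :=
  isGroup.Build Bir bir_mulA bir_mul1 bir_mulr1 bir_mulV bir_mulrV.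

(* The linear transformation (X : Y : Z) |-> (X : Y : Z) A^T. *)
Definition linear_map (A : 'M[K]_3) : triple :=
  [tuple \sum_(j < 3) A i j *: 'X_j | i < 3].

Definition represented_by (t : Bir) (A : 'M[K]_3) :=
  ratmap_eq (bir_triple t) (linear_map A).

(* Coordinates, in the dual plane, of the line joining P to the image of f:   *)
(* the cross product of P and f.  As a line through P is a point of P^1,      *)
(* joining_line P ratmap_id is the projection pi_P.                           *)
Definition joining_line (P : 'rV[K]_3) (f : triple) : triple :=
  [tuple P 0 (i + 1) *: tnth f (i + 2%:R) - P 0 (i + 2%:R) *: tnth f (i + 1)
     | i < 3].

(* G[P], defined by pi_P \o t = pi_P. *)
Definition projection_group (P : 'rV[K]_3) : set Bir :=
  [set t | ratmap_eq (joining_line P (bir_triple t))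
                     (joining_line P ratmap_id)].

(* G_0[P] *)
Definition linear_projection_group (P : 'rV[K]_3) : set Bir :=
  projection_group P `&`
  [set t | exists A, A \in unitmx /\ represented_by t A].

End RationalMaps.

Arguments projection_group {K} F P.
Arguments linear_projection_group {K} F P.

Definition cyclic_subgroup (G : groupType) (A : set G) :=
  exists s : G, A = [set t | exists n : nat, t = (s ^+ n)%g \/ t = (s ^- n)%g].

(* Cardinality of a finite set (0 by convention for an infinite one). *)
Definition set_order (T : choiceType) (A : set T) : nat := #|` fset_set A|.

(* Image of a point, and defining form of the image of the curve F = 0, under *)
(* the linear transformation represented by the invertible matrix M.          *)
Definition image_point (K : fieldType) (M : 'M[K]_3) (P : 'rV[K]_3) : 'rV[K]_3 :=
  P *m M^T.

Definition image_curve (K : fieldType) (M : 'M[K]_3) (F : {mpoly K[3]}) :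
    {mpoly K[3]} :=
  F \mPo linear_map (invmx M).

Definition same_point (K : fieldType) (P Q : 'rV[K]_3) :=
  exists2 c : K, c != 0 & P = c *: Q.

Definition point100 (K : fieldType) : 'rV[K]_3 := delta_mx 0 0.

(* diag(z, 1, 1) *)
Definition diag_z11 (K : fieldType) (z : K) : 'M[K]_3 :=
  diag_mx (\row_(i < 3) (if i == 0 then z else 1)).

(* A polynomial in two variables read as a polynomial in Y and Z. *)
Definition in_YZ (K : fieldType) (H : {mpoly K[2]}) : {mpoly K[3]} :=
  H \mPo [tuple 'X_(lift 0 i) | i < 2].

(* Main.v *)
(* Every element of G_0[P] is represented by a unique matrix 1 + P^T w, and    *)
(* a = 1 + w P^T is multiplicative in w.  Suppose a <> 1.  Then the matrix     *)
(* becomes diag(a, 1, 1) in suitable coordinates sending P to (1 : 0 : 0);     *)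
(* since the irreducible form F has a monomial prime to X, stability of the    *)
(* curve means that a ^ i = 1 for each power X ^ i occurring in F.  As X does  *)
(* occur, a is a root of unity of bounded order; together with the action on   *)
(* the fibres of the projection over two points of P^1 this makes G_0[P]       *)
(* finite.  An elation w (the case a = 1) satisfies |G_0[P]| w = 0, so by the  *)
(* hypothesis on p the homomorphism to K^* given by a is injective.            *)

Require Import Defs.
From mathcomp Require Import all_boot all_order all_algebra.
From mathcomp Require Import cyclic.
From mathcomp Require Import finmap.
From mathcomp Require Import boolp classical_sets cardinality.
From mathcomp Require Import mpoly ring.

Set Implicit Arguments.
Unset Strict Implicit.
Unset Printing Implicit Defensive.

Import GRing.Theory.

Local Open Scope ring_scope.

(** A linear transformation fixing every line through [P] acts on K^3 / P as a scalar, so up to a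
    factor its matrix is 1 + P^T w, a [perspectivity] ([fixed_lines_perspectivity]). Since d > 2,
    proportionality on the curve of two triples of linear forms already holds on the whole plane
    ([ratmap_eq_linear_minors]). Hence [G_0[P]] is in bijection with the set of vectors
    [stabilizer F P], with the law w + a(w) v, where a is the [multiplier].

    This set is finite ([stabilizer_finite]). If its order N is invertible in K, then a is injective
    ([multiplier_inj]) and identifies the group with the N-th roots of unity
    ([multiplier_primitive_root]), whence cyclicity. Moreover n divides N exactly when some
    multiplier is a primitive n-th root of unity zeta. For n >= 2 we have zeta != 1, so
    [diagonalize_perspectivity] gives coordinates in which the matrix is diag(zeta, 1, 1), and
    [stabilized_diag] leaves only powers of X with exponent divisible by n. Conversely, diag(zeta,
    1, 1) pulls back to an element of [stabilizer F P] with multiplier zeta. *)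

Lemma ord3P (i : 'I_3) : [\/ i = 0, i = 1 | i = 2%:R].
Proof.
case: i => [[|[|[|]]]] // p; [apply: Or31 | apply: Or32 | apply: Or33]; exact: val_inj.
Qed.

Lemma lift0_ord3 : lift ord0 ord0 = 1 :> 'I_3.
Proof. exact: val_inj. Qed.

Lemma lift1_ord3 : lift ord0 (lift ord0 ord0) = 2%:R :> 'I_3.
Proof. exact: val_inj. Qed.

(** * Linear substitutions *)

Section LinearSubstitution.
Variable K : fieldType.
Implicit Types (F G u : {mpoly K[3]}) (A B M : 'M[K]_3).

Lemma comp_linear_map u A B :
  (u \mPo linear_map A) \mPo linear_map B = u \mPo linear_map (A *m B).
Proof.
rewrite comp_tuple_mpoly; congr (u \mPo _); apply: eq_from_tnth => i.
rewrite !tnth_mktuple raddf_sum /=.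
under eq_bigr => j _ do
  rewrite comp_mpolyZ comp_mpolyXU -tnth_nth tnth_mktuple scaler_sumr.
rewrite exchange_big /=; apply: eq_bigr => k _.
by rewrite mxE scaler_suml; apply: eq_bigr => j _; rewrite scalerA.
Qed.

Lemma ratmap_comp_linear A B :
  ratmap_comp (linear_map A) (linear_map B) = linear_map (A *m B).
Proof.
apply: eq_from_tnth => i; rewrite tnth_mktuple.
have -> : tnth (linear_map A) i = 'X_i \mPo linear_map A.
  by rewrite comp_mpolyXU -tnth_nth.
by rewrite comp_linear_map comp_mpolyXU -tnth_nth.
Qed.

Lemma linear_map1 : linear_map 1%:M = ratmap_id K.
Proof.
apply: eq_from_tnth => i; rewrite !tnth_mktuple (bigD1 i) //= mxE eqxx scale1r.
by rewrite big1 ?addr0 // => j ji; rewrite mxE eq_sym (negPf ji) scale0r.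
Qed.

Lemma comp_linear_map1 u : u \mPo linear_map 1%:M = u.
Proof. by rewrite linear_map1 comp_mpoly_id. Qed.

Lemma comp_linear_mapK M u : M \in unitmx ->
  (u \mPo linear_map M) \mPo linear_map (invmx M) = u.
Proof. by move=> uM; rewrite comp_linear_map mulmxV ?comp_linear_map1. Qed.

Lemma comp_linear_mapVK M u : M \in unitmx ->
  (u \mPo linear_map (invmx M)) \mPo linear_map M = u.
Proof. by move=> uM; rewrite comp_linear_map mulVmx ?comp_linear_map1. Qed.

Lemma homog_linear_map A i : tnth (linear_map A) i \is 1.-homog.
Proof.
rewrite tnth_mktuple; apply: rpred_sum => j _; apply: rpredZ.
by rewrite dhomogX /= mdeg1.
Qed.

Lemma homog_comp_linear u A k :
  u \is k.-homog -> u \mPo linear_map A \is k.-homog.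
Proof.
by move=> hu; rewrite -[k]mul1n; apply: homog_comp hu (homog_linear_map A).
Qed.

Lemma comp_linear_eq0 u A : A \in unitmx ->
  (u \mPo linear_map A == 0) = (u == 0).
Proof.
move=> uA; apply/eqP/eqP => [E|->]; last exact: comp_mpoly0.
by rewrite -(comp_linear_mapK u uA) E comp_mpoly0.
Qed.

Lemma unit_comp_linear u A :
  u \is a GRing.unit -> u \mPo linear_map A \is a GRing.unit.
Proof. exact: rmorph_unit. Qed.

Lemma irreducible_comp_linear F A : A \in unitmx ->
  irreducible_mpoly F -> irreducible_mpoly (F \mPo linear_map A).
Proof.
move=> uA [F0 Fu Fi]; split; first by rewrite comp_linear_eq0.
  apply: contra Fu => /(@unit_comp_linear _ (invmx A)).
  by rewrite comp_linear_mapK.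
move=> G H E; have := Fi (G \mPo linear_map (invmx A)) (H \mPo linear_map (invmx A)).
rewrite -rmorphM -E /= comp_linear_mapK // => /(_ erefl).
by case=> /(@unit_comp_linear _ A); rewrite comp_linear_mapVK //; [left | right].
Qed.

Lemma dvdF_comp_linear F u A :
  dvdF F u -> dvdF (F \mPo linear_map A) (u \mPo linear_map A).
Proof. by move=> [v ->]; exists (v \mPo linear_map A); rewrite rmorphM. Qed.

Lemma msize_homog u d : u \is d.-homog -> u != 0 -> msize u = d.+1.
Proof.
move=> hu u0; rewrite (mpolySpred _ u0); congr _.+1.
exact: dhomog_uniq u0 (dhomog_msize hu) hu.
Qed.

Lemma dvdF_homog_eq0 F u d e : F \is d.-homog -> F != 0 ->
  u \is e.-homog -> (e < d)%N -> dvdF F u -> u = 0.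
Proof.
move=> hF F0 hu ed [v E]; apply/eqP; apply: contraTT ed => u0.
have v0 : v != 0 by apply: contraNneq u0 => v0; rewrite E v0 mul0r.
have := msizeM v0 F0; rewrite -E (msize_homog hu u0) (msize_homog hF F0).
by rewrite (mpolySpred _ v0) addnS addSn -leqNgt => -[->]; rewrite leq_addl.
Qed.

Lemma dvdF_homog_scale F u d : F \is d.-homog -> F != 0 ->
  u \is d.-homog -> dvdF F u -> exists c, u = c *: F.
Proof.
move=> hF F0 hu [v E]; have [u0|u0] := eqVneq u 0.
  by exists 0; rewrite u0 scale0r.
have v0 : v != 0 by apply: contraNneq u0 => v0; rewrite E v0 mul0r.
have := msizeM v0 F0; rewrite -E (msize_homog hu u0) (msize_homog hF F0).
rewrite addnS /= -{1}[d.+1]add1n => /addIn/esym/eqP/msize_poly1P [c _ vc].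
by exists c; rewrite E vc mul_mpolyC.
Qed.

Lemma mcoeff_sum_msupp u (c : 'X_{1..3} -> K) m :
  (\sum_(k <- msupp u) (u@_k * c k) *: 'X_[k])@_m = u@_m * c m.
Proof.
rewrite raddf_sum /=; under eq_bigr do rewrite mcoeffZ mcoeffX.
have [mu|mu] := boolP (m \in msupp u).
  rewrite (bigD1_seq m) //= eqxx mulr1 big1 ?addr0 // => k /negPf ->.
  by rewrite mulr0.
rewrite (memN_msupp_eq0 mu) mul0r big_seq big1 // => k ku.
by case: eqVneq => [km|]; [rewrite -km ku in mu | rewrite mulr0].
Qed.

Lemma mcoeff_comp_diag u a m :
  (u \mPo linear_map (diag_z11 a))@_m = u@_m * a ^+ m ord0.
Proof.
rewrite -(mcoeff_sum_msupp u (fun k => a ^+ k ord0)) comp_mpolyE.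
congr (_@_m); apply: eq_bigr => k _; rewrite -scalerA; congr (_ *: _).
have E i : tnth (linear_map (diag_z11 a)) i = (if i == ord0 then a else 1) *: 'X_i.
  rewrite tnth_mktuple (bigD1 i) //= big1 ?addr0; last first.
    by move=> j ji; rewrite !mxE [i == j]eq_sym (negPf ji) mulr0n scale0r.
  by rewrite !mxE eqxx mulr1n.
under eq_bigr => i _ do rewrite E exprZn.
rewrite scaler_prod -mpolyXE_id; congr (_ *: _).
rewrite (bigD1 ord0) //= big1 ?mulr1 // => i /negPf ->; exact: expr1n.
Qed.

(** Otherwise ['X_i] divides [F]; irreducibility makes the cofactor constant, and [F] has degree
    1. *)
Lemma irreducible_monomial_eq0 F d i : (1 < d)%N -> F \is d.-homog ->
  irreducible_mpoly F -> exists2 m, m \in msupp F & m i = 0%N.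
Proof.
move=> d1 hF [F0 Fu Fi].
have [/hasP[m mF /eqP mi]|/hasPn noi] := boolP (has (fun m : 'X_{1..3} => m i == 0%N) (msupp F)).
  by exists m.
have E : F = 'X_i * \sum_(m <- msupp F) F@_m *: 'X_[(m - U_(i))%MM].
  rewrite {1}[F]mpolyE mulr_sumr [LHS]big_seq [RHS]big_seq; apply: eq_bigr => m mF.
  by rewrite -scalerAr -mpolyXD addmC submK // lep1mP noi.
have [] := Fi _ _ E.
  by case/andP=> _; rewrite mcoeffX mnm1_eq0 unitr0.
case/andP=> /eqP Ec _; move: E; rewrite Ec => E.
have : F \is 1.-homog.
  by rewrite E mulrC mul_mpolyC; apply: dhomogZ; rewrite dhomogX /= mdeg1.
by move/(dhomog_uniq F0 hF) => d1'; rewrite d1' in d1.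
Qed.

End LinearSubstitution.

(** * Perspectivities and the stabilizer of a form *)

Section Perspectivities.
Variable K : fieldType.
Implicit Types (P w v : 'rV[K]_3) (M : 'M[K]_3) (F : {mpoly K[3]}).

Definition perspectivity P w : 'M[K]_3 := 1%:M + P^T *m w.

(* The determinant of [perspectivity P w].                                    *)
Definition multiplier P w : K := 1 + (w *m P^T) 0 0.

Lemma multiplier0 P : multiplier P 0 = 1.
Proof. by rewrite /multiplier mul0mx mxE addr0. Qed.

Lemma perspectivity0 P : perspectivity P 0 = 1%:M.
Proof. by rewrite /perspectivity mulmx0 addr0. Qed.

(** Since [w *m P^T] is a scalar, the cross term of the product is a multiple of [P^T *m v]. *)
Lemma perspectivityM P w v :
  perspectivity P w *m perspectivity P v = perspectivity P (w + multiplier P w *: v).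
Proof.
rewrite /perspectivity mulmxDl mul1mx mulmxDr mulmx1 -!addrA; congr (_ + _).
rewrite /multiplier scalerDl scale1r !mulmxDr addrCA; congr (_ + (_ + _)).
by rewrite -mulmxA [w *m _]mulmxA {1}[w *m P^T]mx11_scalar mul_scalar_mx.
Qed.

Lemma multiplierM P w v : multiplier P (w + multiplier P w *: v) = multiplier P w * multiplier P v.
Proof.
rewrite /multiplier mulmxDl -scalemxAl.
by move: (w *m P^T) (v *m P^T) => x y; rewrite !mxE; ring.
Qed.

Lemma perspectivityV P w : multiplier P w != 0 ->
  perspectivity P w *m perspectivity P (- (multiplier P w)^-1 *: w) = 1%:M.
Proof.
by move=> r0; rewrite perspectivityM scalerA mulrN divff // scaleN1r subrr perspectivity0.
Qed.

Lemma perspectivity_unit P w : multiplier P w != 0 -> perspectivity P w \in unitmx.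
Proof. by move=> r0; have [] := mulmx1_unit (perspectivityV r0). Qed.

(** [w] is a left eigenvector of the matrix for the eigenvalue [multiplier P w]. If this were 0,
    invertibility would force w = 0, whose multiplier is 1. *)
Lemma multiplier_neq0 P w : perspectivity P w \in unitmx -> multiplier P w != 0.
Proof.
move=> uA; apply/eqP => r0; move/eqP: (r0); apply/negP.
have : w *m perspectivity P w = 0.
  rewrite /perspectivity mulmxDr mulmx1 mulmxA [w *m P^T]mx11_scalar.
  by rewrite mul_scalar_mx -{1}[w]scale1r -scalerDl -/(multiplier P w) r0 scale0r.
move=> /(congr1 (mulmx^~ (invmx (perspectivity P w)))); rewrite mulmxK // mul0mx => ->.
by rewrite multiplier0 oner_neq0.
Qed.

Lemma invmx_perspectivity P w : multiplier P w != 0 ->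
  invmx (perspectivity P w) = perspectivity P (- (multiplier P w)^-1 *: w).
Proof.
move=> r0; rewrite -[RHS]mul1mx -(mulVmx (perspectivity_unit r0)) -mulmxA.
by rewrite perspectivityV // mulmx1.
Qed.

Lemma perspectivity_conj M P w : M \in unitmx ->
  M *m perspectivity P w *m invmx M = perspectivity (P *m M^T) (w *m invmx M).
Proof.
move=> uM; rewrite /perspectivity mulmxDr mulmx1 mulmxDl mulmxV //.
by rewrite trmx_mul trmxK !mulmxA.
Qed.

Lemma multiplier_conj M P w : M \in unitmx ->
  multiplier (P *m M^T) (w *m invmx M) = multiplier P w.
Proof. by move=> uM; rewrite /multiplier trmx_mul trmxK mulmxA mulmxKV. Qed.

Lemma rV_neq0 (n : nat) (u : 'rV[K]_n) : u != 0 -> exists i, u 0 i != 0.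
Proof.
move=> u0; apply/existsP; apply: contraNT u0; rewrite negb_exists => /forallP u0.
by apply/eqP/rowP => i; rewrite mxE; apply/eqP; have := u0 i; rewrite negbK.
Qed.

Lemma linear_map_perspectivity P w i : tnth (linear_map (perspectivity P w)) i =
  'X_i + P 0 i *: \sum_(j < 3) w 0 j *: 'X_j.
Proof.
rewrite tnth_mktuple scaler_sumr.
under eq_bigr do rewrite !mxE big_ord1 !mxE scalerDl.
rewrite big_split /= (bigD1 i) //= eqxx scale1r big1 ?addr0; last first.
  by move=> j ji; rewrite eq_sym (negPf ji) scale0r.
by congr (_ + _); apply: eq_bigr => j _; rewrite scalerA.
Qed.

(** A model of [G_0[P]] inside K^3, free of the scalar ambiguity of matrices and of classes of
    rational maps; finiteness and counting are carried out here. *)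
Definition stabilizer F P : set 'rV[K]_3 := [set w | multiplier P w != 0 /\
  dvdF F (F \mPo linear_map (perspectivity P w))]%classic.

Lemma stabilizer_conj M F P w : M \in unitmx ->
  stabilizer F P w ->
  stabilizer (image_curve M F) (image_point M P) (w *m invmx M).
Proof.
move=> uM [r0 Fw]; split; rewrite /image_point ?multiplier_conj //.
rewrite -perspectivity_conj // /image_curve comp_linear_map !mulmxA mulVmx //.
by rewrite mul1mx -comp_linear_map; apply: dvdF_comp_linear.
Qed.

Lemma stabilizer_conjV M F P w : M \in unitmx ->
  stabilizer (image_curve M F) (image_point M P) w ->
  stabilizer F P (w *m M).
Proof.
move=> uM; have uM' : invmx M \in unitmx by rewrite unitmx_inv.
move=> /(stabilizer_conj uM'); rewrite /image_curve /image_point invmxK.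
by rewrite comp_linear_mapVK // -mulmxA -trmx_mul mulVmx // trmx1 mulmx1.
Qed.

Lemma stabilizer0 F P : stabilizer F P 0.
Proof.
split; rewrite ?multiplier0 ?oner_neq0 // perspectivity0 comp_linear_map1.
by exists 1; rewrite mul1r.
Qed.

Lemma stabilizerM F P w v :
  stabilizer F P w -> stabilizer F P v -> stabilizer F P (w + multiplier P w *: v).
Proof.
move=> [rw Fw] [rv Fv]; split; first by rewrite multiplierM mulf_neq0.
rewrite -perspectivityM -comp_linear_map; apply: dvdF_comp Fw.
exact: Fv.
Qed.

(** Between forms of equal degree, divisibility is proportionality by a constant, here nonzero and
    so invertible. *)
Lemma stabilizerV d F P w : F \is d.-homog -> F != 0 ->
  stabilizer F P w -> stabilizer F P (- (multiplier P w)^-1 *: w).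
Proof.
move=> hF F0 [rw Fw]; split.
  have := multiplierM P w (- (multiplier P w)^-1 *: w).
  rewrite scalerA mulrN divff // scaleN1r subrr multiplier0 => /esym/eqP.
  by apply: contraTneq => ->; rewrite mulr0 eq_sym oner_eq0.
have uA := perspectivity_unit rw.
have [c E] := dvdF_homog_scale hF F0 (homog_comp_linear _ hF) Fw.
have c0 : c != 0.
  by apply: contraNneq F0 => c0; rewrite -(comp_linear_eq0 _ uA) E c0 scale0r.
exists c^-1%:MP; rewrite mul_mpolyC -invmx_perspectivity //.
apply: (scalerI c0); rewrite scalerA divff // scale1r -comp_mpolyZ -E.
exact: comp_linear_mapK.
Qed.

End Perspectivities.

(** * Elements of the linear projection group *)

Section LinearProjectionGroup.
Variables (K : fieldType) (F : {mpoly K[3]}) (d : nat) (P : 'rV[K]_3).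
Hypotheses (d_gt2 : (2 < d)%N) (homF : F \is d.-homog) (F_neq0 : F != 0).
Hypothesis P_neq0 : P != 0.
Implicit Types (f g : 3.-tuple {mpoly K[3]}) (A B M : 'M[K]_3) (w v : 'rV[K]_3).

Lemma represented_by_scale (t : Bir F) c A : c != 0 ->
  represented_by t (c *: A) -> represented_by t A.
Proof.
move=> c0 [a [b [ra [[e hb] rb] E]]]; exists a, (c *: b); split=> //.
  split; first by exists e; apply: rpredZ.
  move=> u k hu [q Eq]; apply: (rb _ _ hu); exists (c^-1 *: q).
  by rewrite -scalerAl -Eq -scalerAl scalerA mulVf // scale1r.
move=> i; have := E i; rewrite !tnth_mktuple.
have -> : \sum_j (c *: A) i j *: 'X_j = c *: \sum_j A i j *: ('X_j : {mpoly K[3]}).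
  by rewrite scaler_sumr; apply: eq_bigr => j _; rewrite mxE scalerA.
by rewrite -scalerAr -scalerAl.
Qed.

(** [F] composed with [t] vanishes on the curve and agrees there with [F] composed with the linear
    map, up to the factors a^d and b^d; the latter can be cancelled. *)
Lemma represented_by_dvdF (t : Bir F) A :
  represented_by t A -> dvdF F (F \mPo linear_map A).
Proof.
move=> [a [b [_ rb E]]]; have [[_ Ft] _] := bir_tripleP t.
have [_ reg] := nonzerodivX d rb.
apply: (reg _ d); first exact: homog_comp_linear.
by apply: dvdFB (dvdFC (prop_comp homF E)) _; apply: dvdFM.
Qed.

(** Each minor is a quadratic form which, after cancelling [a], is divisible by [F]; as d > 2, it is
    zero. *)
Lemma ratmap_eq_linear_minors f g : ratmap_eq F f g ->
  (forall i, tnth f i \is 1.-homog) -> (forall i, tnth g i \is 1.-homog) ->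
  forall i j, tnth f i * tnth g j = tnth f j * tnth g i.
Proof.
move=> [a [b [[ha ra] _ E]]] hf hg i j; apply/eqP; rewrite -subr_eq0; apply/eqP.
have h2 : tnth f i * tnth g j - tnth f j * tnth g i \is 2.-homog.
  by apply: rpredB; apply: (@dhomogM _ _ _ 1 _ 1).
apply: (dvdF_homog_eq0 homF F_neq0 h2 d_gt2); apply: (ra _ _ h2).
have -> : a * (tnth f i * tnth g j - tnth f j * tnth g i) =
  tnth g j * (a * tnth f i - b * tnth g i) - tnth g i * (a * tnth f j - b * tnth g j).
  by ring.
by apply: dvdFD; [|apply: dvdFN]; apply: dvdFM.
Qed.

Lemma joining_line_eq f g : ratmap_eq F f g ->
  ratmap_eq F (joining_line P f) (joining_line P g).
Proof.
move=> [a [b [ra rb E]]]; exists a, b; split=> // i; rewrite !tnth_mktuple.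
have -> (x y : K) (u u' v v' : {mpoly K[3]}) :
    a * (x *: u - y *: v) - b * (x *: u' - y *: v') =
    x%:MP * (a * u - b * u') - y%:MP * (a * v - b * v').
  by rewrite -!mul_mpolyC; ring.
by apply: dvdFD; [|apply: dvdFN]; apply: dvdFM.
Qed.

Lemma joining_line_homog A i : tnth (joining_line P (linear_map A)) i \is 1.-homog.
Proof.
by rewrite tnth_mktuple; apply: rpredB; apply: rpredZ; apply: homog_linear_map.
Qed.

Lemma joining_line_perspectivity w :
  joining_line P (linear_map (perspectivity P w)) = joining_line P (ratmap_id K).
Proof.
apply: eq_from_tnth => i; rewrite [LHS]tnth_mktuple [RHS]tnth_mktuple.
rewrite !linear_map_perspectivity !tnth_mktuple !scalerDr !scalerA [P 0 (i + 2%:R) * _]mulrC.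
by rewrite opprD addrACA subrr addr0.
Qed.

Lemma stabilizer_birational w : stabilizer F P w ->
  birational F (linear_map (perspectivity P w)).
Proof.
move=> sw; have [_ Fw'] := stabilizerV homF F_neq0 sw; have [rw Fw] := sw.
have hom A : homog_triple (linear_map A) by exists 1%N => i; apply: homog_linear_map.
split; first by split.
exists (linear_map (perspectivity P (- (multiplier P w)^-1 *: w))); split; first by split.
  rewrite ratmap_comp_linear -invmx_perspectivity // mulVmx ?perspectivity_unit //.
  by rewrite linear_map1; apply: ratmap_eq_refl.
by rewrite ratmap_comp_linear perspectivityV // linear_map1; apply: ratmap_eq_refl.
Qed.

Lemma stabilizer_represented w : stabilizer F P w ->
  exists2 t, linear_projection_group F P t & represented_by t (perspectivity P w).
Proof.
move=> sw; have bw := stabilizer_birational sw.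
have tw : represented_by (bir_class bw) (perspectivity P w) by apply: bir_class_triple.
exists (bir_class bw) => //; split; last first.
  by exists (perspectivity P w); split=> //; apply: perspectivity_unit; case: sw.
rewrite /projection_group /= -(joining_line_perspectivity w).
exact: joining_line_eq.
Qed.

Lemma represented_by_inj (s t : Bir F) A :
  represented_by s A -> represented_by t A -> s = t.
Proof.
move=> sA tA; apply: bir_eqP; apply: ratmap_eq_trans sA _.
exact: ratmap_eq_sym.
Qed.

Lemma represented_by_mul (s t : Bir F) A B :
  represented_by s A -> represented_by t B -> represented_by (s * t)%g (A *m B).
Proof.
move=> sA tB; apply: ratmap_eq_trans (bir_mul_triple _ _) _.
rewrite -ratmap_comp_linear.
apply: (ratmap_eq_trans (ratmap_comp_eqr (bir_tripleP t) sA)).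
by apply: ratmap_comp_eql tB; exists 1%N => i; apply: homog_linear_map.
Qed.

Lemma represented_by_perspectivity_inj (t : Bir F) w v :
  represented_by t (perspectivity P w) -> represented_by t (perspectivity P v) ->
  w = v.
Proof.
move=> tw tv; have [i Pi] := rV_neq0 P_neq0.
have minors := ratmap_eq_linear_minors (ratmap_eq_trans (ratmap_eq_sym tw) tv)
  (homog_linear_map _) (homog_linear_map _).
pose lin (u : 'rV[K]_3) : {mpoly K[3]} := \sum_(j < 3) u 0 j *: 'X_j.
have linE u j : (lin u)@_U_(j)%MM = u 0 j.
  rewrite raddf_sum (bigD1 j) //= mcoeffZ mcoeffXU eqxx mulr1 big1 ?addr0 //.
  by move=> k kj; rewrite mcoeffZ mcoeffXU (negPf kj) mulr0.
pose j := i + 1; have ij : i != j by case: (i) @j => [[|[|[|]]]].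
suff E : lin v = lin w by apply/rowP => k; rewrite -!linE E.
(* The minor at (i, j) factors as (P_j X_i - P_i X_j) times the difference of the linear forms of
   [v] and [w]. The first factor is nonzero because P_i is. *)
have c0 : P 0 j *: 'X_i - P 0 i *: 'X_j != 0 :> {mpoly K[3]}.
  apply: contraNneq Pi => /(congr1 (mcoeff U_(j))).
  rewrite mcoeffB !mcoeffZ !mcoeffXU eqxx (negPf ij) mulr0 mulr1 sub0r mcoeff0.
  by move/eqP; rewrite oppr_eq0.
apply: (mulfI c0); have := minors i j; rewrite !linear_map_perspectivity.
rewrite -![_ *: \sum_(_ < 3) _](mul_mpolyC) -![_ *: 'X__]mul_mpolyC.
rewrite -/(lin v) -/(lin w).
move=> E; apply/eqP; rewrite -subr_eq0; apply/eqP; move/eqP: E; rewrite -subr_eq0.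
move/eqP=> <-; ring.
Qed.

End LinearProjectionGroup.

(** * Linear transformations fixing all lines through a point *)

Lemma quotient_scalar_mx (K : fieldType) (B : 'M[K]_3) :
  (forall v : 'rV_3, (v *m B) 0 1 * v 0 2%:R = (v *m B) 0 2%:R * v 0 1) ->
  B = (B 1 1)%:M + col 0 (B - (B 1 1)%:M) *m point100 K.
Proof.
move=> B_eigen.
have Brow i j : ((delta_mx 0 i : 'rV_3) *m B) 0 j = B i j by rewrite -rowE mxE.
(* Basis vectors give B_12 = B_21 = 0. Sums of two basis vectors give B_11 = B_22 and B_01 = B_02 =
   0. *)
have Bij i j : (B i 1 + B j 1) * ((2%:R == i)%:R + (2%:R == j)%:R) =
               (B i 2%:R + B j 2%:R) * ((1 == i)%:R + (1 == j)%:R).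
  have E k : ((delta_mx 0 i + delta_mx 0 j : 'rV_3) *m B) 0 k = B i k + B j k.
    by rewrite mulmxDl mxE !Brow.
  by have := B_eigen (delta_mx 0 i + delta_mx 0 j); rewrite !E !mxE.
have Bi i : B i 1 * (2%:R == i)%:R = B i 2%:R * (1 == i)%:R.
  by have := B_eigen (delta_mx 0 i); rewrite !Brow !mxE.
have B12 : B 1 2%:R = 0 by have := Bi 1; rewrite /= mulr0 mulr1.
have B21 : B 2%:R 1 = 0 by have := Bi 2%:R; rewrite /= mulr0 mulr1.
have B11 : B 1 1 = B 2%:R 2%:R.
  by have := Bij 1 2%:R; rewrite /= B12 B21 !(addr0, add0r) !mulr1.
have B01 : B 0 1 = 0.
  by have := Bij 0 2%:R; rewrite /= B21 !(addr0, add0r) mulr0 mulr1.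
have B02 : B 0 2%:R = 0.
  by have := Bij 0 1; rewrite /= B12 !(addr0, add0r) mulr0 mulr1.
apply/matrixP => i j; rewrite [RHS]mxE [X in _ + X]mxE big_ord1 !mxE.
case: (ord3P i) => ->; case: (ord3P j) => -> /=;
  rewrite ?(B12, B21, B01, B02) ?B11 ?(mulr0, mulr1, mulr0n, mulr1n, subr0) ?addr0 ?add0r //.
by rewrite addrC subrK.
Qed.

Section LinesThroughAPoint.
Variables (K : fieldType) (P : 'rV[K]_3).
Hypothesis P_neq0 : P != 0.
Implicit Types (A M N : 'M[K]_3) (u v : 'rV[K]_3).

Lemma exists_point100 : exists2 M, M \in unitmx & P *m M^T = point100 K.
Proof.
(* A nonzero row has rank 1, so this factorization reads P = c (1, 0, 0) R with R invertible. *)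
have := mulmx_ebase P; rewrite rank_rV P_neq0 [col_ebase P]mx11_scalar.
set c := _ 0 0 => E.
have c0 : c != 0.
  by apply: contraNneq P_neq0 => c0; rewrite -E c0 mul_scalar_mx scale0r mul0mx.
exists (c^-1 *: invmx (row_ebase P))^T.
  by rewrite unitmx_tr unitmxZ ?unitmx_inv ?row_ebase_unit // unitfE invr_eq0.
rewrite trmxK -scalemxAr -{1}E mulmxK ?row_ebase_unit // mul_scalar_mx scalerA.
rewrite mulVf // scale1r; apply/matrixP => i j; rewrite !mxE !ord1.
by case: j => [[|[|[|]]]].
Qed.

Let cross u (i : 'I_3) := P 0 (i + 1) * u 0 (i + 2%:R) - P 0 (i + 2%:R) * u 0 (i + 1).

Lemma cross_eq0 u : (forall i, cross u i = 0) -> exists b, u = b *: P.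
Proof.
move=> c0; have [k Pk] := rV_neq0 P_neq0.
exists (u 0 k / P 0 k); apply/rowP => j; rewrite mxE.
apply: (mulIf Pk); rewrite mulrAC divfK // mulrC [RHS]mulrC.
have {}c0 i : P 0 (i + 1) * u 0 (i + 2%:R) = P 0 (i + 2%:R) * u 0 (i + 1).
  by apply/eqP; rewrite -subr_eq0; apply/eqP; exact: c0.
have [[E0 E1] E2] := (c0 0, c0 1, c0 2%:R).
have z : [/\ 0 + 1 = 1 :> 'I_3, 0 + 2%:R = 2%:R :> 'I_3, 1 + 2%:R = 0 :> 'I_3,
  2%:R + 1 = 0 :> 'I_3 & 2%:R + 2%:R = 1 :> 'I_3] by split; apply: val_inj.
case: z => z1 z2 z3 z4 z5; rewrite z1 z2 in E0; rewrite z3 in E1; rewrite z4 z5 in E2.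
have z6 : 1 + 1 = 2%:R :> 'I_3 by apply: val_inj.
rewrite z6 in E1.
case: (ord3P k) => ->; case: (ord3P j) => ->.
all: by rewrite ?E0 ?E1 ?E2.
Qed.

Lemma meval_joining_line A v i :
  (tnth (joining_line P (linear_map A)) i).@[v 0] = cross (v *m A^T) i.
Proof.
rewrite tnth_mktuple mevalB !mevalZ /cross.
have E k : (tnth (linear_map A) k).@[v 0] = (v *m A^T) 0 k.
  rewrite tnth_mktuple raddf_sum mxE /=; apply: eq_bigr => j _.
  by rewrite mevalZ mevalXU mxE mulrC.
by rewrite !E.
Qed.

(* A linear transformation fixing every line through P acts on the quotient   *)
(* of K^3 by P as a scalar, since there every vector is an eigenvector.       *)
Lemma fixed_lines_perspectivity A : A \in unitmx ->
  (forall i j, tnth (joining_line P (linear_map A)) i *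
                 tnth (joining_line P (ratmap_id K)) j =
               tnth (joining_line P (linear_map A)) j *
                 tnth (joining_line P (ratmap_id K)) i) ->
  exists c w, c != 0 /\ A = c *: perspectivity P w.
Proof.
move=> uA minors.
(* Evaluated at [v], the minors say that, if [v] differs from [P], its image lies on the line
   joining [P] and [v]. *)
have eigen v : (exists b, v = b *: P) \/ exists c b, v *m A^T = c *: v + b *: P.
  have {}minors i j : cross (v *m A^T) i * cross v j = cross (v *m A^T) j * cross v i.
    have := congr1 (meval (v 0)) (minors i j).
    by rewrite -linear_map1 !mevalM !meval_joining_line trmx1 mulmx1.
  have [/forallP/= c0|] := boolP [forall i, cross v i == 0].
    by left; apply: cross_eq0 => i; apply/eqP.
  rewrite negb_forall => /existsP[j cj]; right.
  pose c := cross (v *m A^T) j / cross v j.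
  have [|b E] := @cross_eq0 (v *m A^T - c *: v).
    move=> i; have -> : cross (v *m A^T - c *: v) i = cross (v *m A^T) i - c * cross v i.
      by rewrite /cross; move: (v *m A^T) => u; rewrite !mxE; ring.
    apply/eqP; rewrite subr_eq0; apply/eqP; apply: (mulIf cj).
    by rewrite minors /c mulrAC divfK.
  by exists c, b; rewrite -E addrC subrK.
have [M uM PM] := exists_point100.
pose N := invmx M^T; have uMT : M^T \in unitmx by rewrite unitmx_tr.
have NP : point100 K *m N = P by rewrite -PM mulmxK.
(* The transformation in coordinates where [P] is (1 : 0 : 0), so that the quotient by [P] is seen
   in the last two coordinates. *)
pose B := N *m A^T *m M^T.
have B_eigen v : (v *m B) 0 1 * v 0 2%:R = (v *m B) 0 2%:R * v 0 1.
  have vE : v = v *m N *m M^T by rewrite mulmxKV.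
  have e1 : point100 K 0 1 = 0 by rewrite mxE.
  have e2 : point100 K 0 2%:R = 0 by rewrite mxE.
  have [[b E]|[c [b E]]] := eigen (v *m N).
    by rewrite vE E -scalemxAl PM !mxE !mulr0.
  have -> : v *m B = c *: v + b *: point100 K.
    by rewrite /B !mulmxA E mulmxDl -!scalemxAl mulmxKV // PM.
  by rewrite !mxE /= !mulr0 !addr0 mulrAC.
have BE := quotient_scalar_mx B_eigen.
pose q := M^T *m col 0 (B - (B 1 1)%:M).
have AE : A = (B 1 1)%:M + P^T *m q^T.
  have AT : A^T = M^T *m B *m N.
    by rewrite /B !mulmxA mulmxV // mul1mx mulmxK.
  apply: trmx_inj; rewrite linearD /= trmx_mul !trmxK tr_scalar_mx AT.
  rewrite {1}BE mulmxDr mulmxDl scalar_mxC mulmxK // /q; congr (_ + _).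
  by rewrite -!mulmxA NP.
have c0 : B 1 1 != 0.
  apply: contraTneq uA => c0; rewrite AE c0 raddf0 add0r -row_free_unit /row_free.
  by rewrite neq_ltn (leq_ltn_trans (mulmx_max_rank _ _)).
exists (B 1 1), ((B 1 1)^-1 *: q^T); split=> //.
by rewrite /perspectivity scalerDr scalemx1 -scalemxAr scalerA divff // scale1r.
Qed.

End LinesThroughAPoint.

(** Invariance of the projection, given on the curve only, becomes an identity of minors on the
    whole plane. With [stabilizer_represented] this matches group and stabilizer. *)
Lemma linear_projection_group_stabilizer (K : fieldType) (F : {mpoly K[3]})
    (d : nat) (P : 'rV[K]_3) (t : Bir F) :
  (2 < d)%N -> F \is d.-homog -> F != 0 -> P != 0 ->
  linear_projection_group F P t ->
  exists2 w, stabilizer F P w & represented_by t (perspectivity P w).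
Proof.
move=> d2 hF F0 P0 [tP [A [uA tA]]].
have minors : forall i j, tnth (joining_line P (linear_map A)) i *
    tnth (joining_line P (ratmap_id K)) j =
    tnth (joining_line P (linear_map A)) j *
    tnth (joining_line P (ratmap_id K)) i.
  apply: (ratmap_eq_linear_minors d2 hF F0).
  - exact: ratmap_eq_trans (ratmap_eq_sym (joining_line_eq P tA)) tP.
  - exact: joining_line_homog.
  - by rewrite -linear_map1; apply: joining_line_homog.
have [c [w [c0 AE]]] := fixed_lines_perspectivity P0 uA minors.
have tw : represented_by t (perspectivity P w).
  by apply: (represented_by_scale c0); rewrite -AE.
exists w => //; split; last exact: (represented_by_dvdF hF tw).
by apply: multiplier_neq0; move: uA; rewrite AE unitmxZ // unitfE.
Qed.

(** * Finiteness *)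

Section Dehomogenization.
Variable K : fieldType.
Implicit Types (F : {mpoly K[3]}) (m : 'X_{1..3}).

Lemma mnm3_eq m n : mdeg m = mdeg n -> m 0 = n 0 -> m 2%:R = n 2%:R -> m = n.
Proof.
rewrite !mdegE !big_ord_recl !big_ord0 => E E0 E2; apply/mnmP => i.
move: E; rewrite lift0_ord3 lift1_ord3 [m ord0]E0 E2 => /addnI/addIn E1.
by case: (ord3P i) => ->.
Qed.

(* F(X, 1, T) as a polynomial in X over K[T].                                 *)
Definition dehomogenize F : {poly {poly K}} :=
  \sum_(m <- msupp F) (F@_m *: 'X^(m 2%:R))%:P * 'X^(m 0).

Definition affine_point (x t : K) (i : 'I_3) : K := nth 0 [:: x; 1; t] i.

Lemma horner_dehomogenize F x t :
  (dehomogenize F).[x%:P].[t] = F.@[affine_point x t].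
Proof.
rewrite mevalE !horner_sum; apply: eq_bigr => m _.
rewrite !big_ord_recl big_ord0 /affine_point /= expr1n.
rewrite hornerCM hornerXn -rmorphXn hornerM hornerC hornerZ hornerXn.
by rewrite lift1_ord3; ring.
Qed.

(** The degree determines the exponent of Y from the other two, so distinct monomials of [F] do not
    collide. *)
Lemma coef_dehomogenize F d m : F \is d.-homog -> m \in msupp F ->
  (dehomogenize F)`_(m 0)`_(m 2%:R) = F@_m.
Proof.
move=> /dhomogP hF mF; rewrite !coef_sum (bigD1_seq m) //=.
rewrite coefCM coefXn eqxx mulr1 coefZ coefXn eqxx mulr1 big_seq_cond big1 ?addr0 //.
move=> n /andP[nF nm]; rewrite coefCM coefXn.
have [E0|_] := eqVneq (m 0) (n 0); last by rewrite mulr0 coef0.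
rewrite mulr1 coefZ coefXn; have [E2|_] := eqVneq (m 2%:R) (n 2%:R); last by rewrite mulr0.
by move: nm; rewrite (mnm3_eq _ E0 E2) ?eqxx // !hF.
Qed.

End Dehomogenization.

(** For a = 0: a substitution mixing only Y and Z commutes with setting X = 0, hence introduces no
    X. *)
Lemma diag_z11_comm (K : fieldType) (P w : 'rV[K]_3) (a : K) :
  P 0 0 = 0 -> w 0 0 = 0 ->
  perspectivity P w *m diag_z11 a = diag_z11 a *m perspectivity P w.
Proof.
move=> P0 w0; rewrite /perspectivity mulmxDl mulmxDr mul1mx mulmx1; congr (_ + _).
have -> : P^T *m w *m diag_z11 a = P^T *m w.
  rewrite -mulmxA; congr (_ *m _); rewrite mul_mx_diag; apply/rowP => j.
  by rewrite !mxE; case: eqVneq => [->|]; rewrite ?w0 ?mul0r ?mulr1.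
rewrite mulmxA; congr (_ *m _); rewrite mul_diag_mx; apply/matrixP => i j.
by rewrite !mxE !ord1; case: eqVneq => [->|]; rewrite ?P0 ?mulr0 ?mul1r.
Qed.

(** * Monomials of irreducible forms *)

Section IrreducibleForms.
Variables (K : closedFieldType) (F : {mpoly K[3]}) (d : nat).
Hypotheses (d_gt1 : (1 < d)%N) (homF : F \is d.-homog) (irrF : irreducible_mpoly F).

(* A binary form of degree at least 2 has a linear factor: after a linear     *)
(* change of coordinates, one of the variables.                               *)
Lemma irreducible_monomial_neq0 : exists2 m, m \in msupp F & m 0 != 0%N.
Proof.
have [/hasP[m mF /= m0]|/hasPn all0] :=
  boolP (has (fun m : 'X_{1..3} => m 0 != 0%N) (msupp F)); first by exists m.
have {}all0 m : m \in msupp F -> m 0 = 0%N by move=> /all0; rewrite negbK => /eqP.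
have [m mF m1] := irreducible_monomial_eq0 1 d_gt1 homF irrF.
(* X being absent, a monomial prime to Y is Z^d; thus F(0, 1, T) is not constant and has a root. *)
have [t] : exists t, root (dehomogenize F)`_0 t.
  apply/closed_rootP; have c := coef_dehomogenize homF mF.
  have m2 : m 2%:R = d.
    have <- : mdeg m = d by move/dhomogP: homF => /(_ m mF).
    rewrite mdegE !big_ord_recl big_ord0.
    by rewrite lift0_ord3 lift1_ord3 [m ord0]all0 // m1 addn0.
  rewrite all0 // m2 in c; rewrite neq_ltn orbC (leq_trans d_gt1) //.
  rewrite ltnW // ltnNge; apply: contraTN mF => /(nth_default 0) E.
  by rewrite mcoeff_msupp -c E eqxx.
rewrite rootE -horner_coef0 -[0](polyC0) horner_dehomogenize => /eqP Ft.
(* This is the substitution of Z + t Y for Z; it moves the zero (0 : 1 : t) to (0 : 1 : 0). *)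
pose A := perspectivity (delta_mx 0 2%:R) (t *: delta_mx 0 1) : 'M[K]_3.
have uA : A \in unitmx.
  apply: perspectivity_unit; rewrite /multiplier -scalemxAl trmx_delta.
  by rewrite mul_delta_mx_0 // scaler0 mxE addr0 oner_eq0.
have DF : F \mPo linear_map (diag_z11 0) = F.
  apply/mpolyP => n; rewrite mcoeff_comp_diag; have [nF|nF] := boolP (n \in msupp F).
    by rewrite [n ord0]all0 // expr0 mulr1.
  by rewrite (memN_msupp_eq0 nF) mul0r.
pose G := F \mPo linear_map A.
have DG : G \mPo linear_map (diag_z11 0) = G.
  by rewrite comp_linear_map diag_z11_comm ?mxE ?mulr0 // -comp_linear_map DF.
have homG : G \is d.-homog by apply: homog_comp_linear.
(* A monomial of [G] prime to Z must be Y^d. Its coefficient is the value of [G] at (0, 1, 0), which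
   is F(0, 1, t) = 0: a contradiction. *)
have [n nG n2] := irreducible_monomial_eq0 2%:R d_gt1 homG (irreducible_comp_linear uA irrF).
have all0G k : k \in msupp G -> k 0 = 0%N.
  rewrite mcoeff_msupp -DG mcoeff_comp_diag; case: (eqVneq (k 0) 0%N) => // k0.
  by rewrite expr0n (negPf k0) mulr0 eqxx.
have : G.@[affine_point 0 0] = F.@[affine_point 0 t].
  rewrite comp_mpoly_meval; apply: meval_eq => i; rewrite linear_map_perspectivity.
  rewrite mevalD mevalXU mevalZ raddf_sum /= !big_ord_recl big_ord0.
  rewrite !mevalZ !mevalXU !mxE /affine_point.
  by case: (ord3P i) => -> /=; rewrite ?mxE /=; ring.
rewrite Ft -horner_dehomogenize polyC0 !horner_coef0 => /eqP.
have := coef_dehomogenize homG nG; rewrite all0G // n2 => ->.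
by rewrite mcoeff_eq0 nG.
Qed.

(* A monomial prime to X forces the factor of proportionality to be 1.        *)
Lemma stabilized_diag (a : K) : dvdF F (F \mPo linear_map (diag_z11 a)) ->
  forall m, m \in msupp F -> a ^+ m 0 = 1.
Proof.
have [F0 _ _] := irrF.
move=> /(dvdF_homog_scale homF F0 (homog_comp_linear _ homF)) [c E].
have Ec m : m \in msupp F -> a ^+ m 0 = c.
  rewrite mcoeff_msupp => mF; apply: (mulfI mF).
  by rewrite -mcoeff_comp_diag E mcoeffZ mulrC.
have [m mF m0] := irreducible_monomial_eq0 0 d_gt1 homF irrF.
have c1 : c = 1 by rewrite -(Ec _ mF) m0 expr0.
by move=> k /Ec ->.
Qed.

End IrreducibleForms.

(** * Normal form of a homology *)

Lemma point100_neq0 (K : fieldType) : point100 K != 0.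
Proof. by apply/eqP => /rowP/(_ 0)/eqP; rewrite !mxE oner_eq0. Qed.

Lemma multiplier_point100 (K : fieldType) (w : 'rV[K]_3) :
  multiplier (point100 K) w = 1 + w 0 0.
Proof. by rewrite /multiplier /point100 trmx_delta -colE mxE. Qed.

Lemma diag_z11_perspectivity (K : fieldType) (a c : K) :
  perspectivity (a *: point100 K) (c *: point100 K) = diag_z11 (1 + a * c).
Proof.
apply/matrixP => i j; rewrite !mxE big_ord1 !mxE.
by case: (ord3P i) => ->; case: (ord3P j) => -> /=; rewrite ?mulr1n ?mulr0n; ring.
Qed.

(** Once [P] is moved to (1 : 0 : 0), the linear form given by [w] is nonzero at [P], so the axis
    avoids the centre and a shear fixing the centre moves it to X = 0. *)
Lemma diagonalize_perspectivity (K : fieldType) (P w : 'rV[K]_3) :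
  P != 0 -> multiplier P w != 1 ->
  exists M, [/\ M \in unitmx, image_point M P = point100 K
    & w *m invmx M = (multiplier P w - 1) *: point100 K].
Proof.
move=> P0 a1; have [M uM PM] := exists_point100 P0.
pose e := point100 K; pose c := multiplier P w - 1; pose v := w *m invmx M.
have c0 : c != 0 by rewrite subr_eq0.
have ee : e *m e^T = 1%:M.
  by rewrite /e /point100 trmx_delta mul_delta_mx; apply/matrixP => i j; rewrite !mxE !ord1.
have ve : v *m e^T = c%:M.
  rewrite [LHS]mx11_scalar; congr (_%:M); rewrite /c -(multiplier_conj P w uM) PM.
  by rewrite /multiplier addrC addKr.
(* [u] is chosen to kill [e], so that [N] fixes [e], and to make [e *m N] equal to [c^-1 *: v]. *)
pose u := c^-1 *: v - e; pose N := perspectivity e u.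
have ue : u *m e^T = 0.
  by rewrite mulmxBl -scalemxAl ve ee scale_scalar_mx mulVf // subrr.
have uN : N \in unitmx.
  by apply: perspectivity_unit; rewrite /multiplier ue mxE addr0 oner_eq0.
exists (N *m M); split; first by rewrite unitmx_mul uN.
  rewrite /image_point trmx_mul mulmxA PM /N /perspectivity linearD /= trmx1.
  have eu : e *m u^T = 0 by rewrite -[e]trmxK -trmx_mul ue trmx0.
  by rewrite trmx_mul trmxK mulmxDr mulmx1 mulmxA eu mul0mx addr0.
have -> : invmx (N *m M) = invmx M *m invmx N.
  have uNM : N *m M \in unitmx by rewrite unitmx_mul uN.
  apply: (can_inj (mulmxK uNM)); rewrite mulVmx // mulmxA mulmxKV //.
  by rewrite mulVmx.
rewrite mulmxA -/v -/c -/e; apply: (canLR (mulmxK uN)).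
rewrite -scalemxAl /N /perspectivity mulmxDr mulmx1 mulmxA ee mul1mx.
by rewrite addrC subrK scalerA divff // scale1r.
Qed.

(** * Fibres of the projection and finiteness *)

Lemma finite_root (K : closedFieldType) (p : {poly K}) :
  p != 0 -> finite_set [set x | root p x]%classic.
Proof.
move=> p0; have [r E] := closed_field_poly_normal p.
apply: (@sub_finite_set _ _ [set` r]%classic); last exact: finite_seq.
by move=> x /=; rewrite {1}E rootZ ?lead_coef_eq0 // root_prod_XsubC.
Qed.

Section Finiteness.
Variables (K : closedFieldType) (F : {mpoly K[3]}) (d : nat).
Hypotheses (d_gt1 : (1 < d)%N) (homF : F \is d.-homog) (irrF : irreducible_mpoly F).

(** If a != 1, the diagonal form yields a^i = 1 for some X^i with 0 < i <= d occurring in the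
    equation; d! is a common multiple of all such i. *)
Lemma stabilizer_multiplier (P w : 'rV[K]_3) : P != 0 -> stabilizer F P w ->
  multiplier P w ^+ d`! = 1.
Proof.
move=> P0 sw; have [->|a1] := eqVneq (multiplier P w) 1; first exact: expr1n.
have [M [uM PM wM]] := diagonalize_perspectivity P0 a1.
have [_] := stabilizer_conj uM sw; set a := multiplier P w in wM *.
rewrite PM wM -[point100 K in X in perspectivity X]scale1r diag_z11_perspectivity.
rewrite mul1r addrC subrK => Da.
have uM' : invmx M \in unitmx by rewrite unitmx_inv.
have homG := homog_comp_linear (invmx M) homF.
have irrG := irreducible_comp_linear uM' irrF.
have [m mG m0] := irreducible_monomial_neq0 d_gt1 homG irrG.
have : (m 0%R %| d`!)%N.
  apply: dvdn_fact; rewrite lt0n m0 /=.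
  have <- : mdeg m = d by move/dhomogP: homG => /(_ m mG).
  by rewrite mdegE (bigD1 0%R) //= leq_addr.
by move=> /dvdnP[k ->]; rewrite mulnC exprM (stabilized_diag d_gt1 homG irrG Da mG) expr1n.
Qed.

(** It suffices that the leading coefficient of [F] in X does not vanish at [t]. The polynomial [g]
    serves to exclude further values of [t]. *)
Lemma exists_finite_fiber (g : {poly K}) : g != 0 -> exists t,
  [/\ ~~ root g t, finite_set [set x | F.@[affine_point x t] = 0]%classic
    & exists x, F.@[affine_point x t] = 0].
Proof.
move=> g0; have [m mF m0] := irreducible_monomial_neq0 d_gt1 homF irrF.
set p := dehomogenize F.
have size_p : (1 < size p)%N.
  rewrite ltnNge; apply: contraTN (mF) => le1.
  rewrite mcoeff_msupp -(coef_dehomogenize homF mF) -/p.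
  by rewrite (@nth_default _ 0 p) ?coef0 ?eqxx // (leq_trans le1) // lt0n.
have p0 : p != 0 by rewrite -size_poly_gt0 ltnW.
have [t] : exists t, ~~ root (lead_coef p * g) t.
  by apply/closed_nonrootP; rewrite mulf_neq0 ?lead_coef_eq0.
rewrite rootM negb_or => /andP[pt gt]; exists t.
pose q := map_poly (horner_eval t) p.
have size_q : size q = size p by apply: size_map_poly_id0.
have qE x : q.[x] = F.@[affine_point x t].
  rewrite -horner_dehomogenize -[x in LHS](hornerC x t).
  exact: (horner_map (horner_eval t) p x%:P).
split=> //.
  rewrite (_ : mkset _ = [set x | root q x]%classic).
    by apply: finite_root; rewrite -size_poly_gt0 size_q ltnW.
  by apply/seteqP; split=> x /=; rewrite -qE => /eqP.
have /closed_rootP[x /eqP qx] : size q != 1 by rewrite size_q neq_ltn size_p orbT.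
by exists x; rewrite -qE.
Qed.

Lemma stabilizer_affine_point (w : 'rV[K]_3) (x t : K) :
  stabilizer F (point100 K) w -> F.@[affine_point x t] = 0 ->
  F.@[affine_point (x + (w 0 0 * x + w 0 1 + w 0 2%:R * t)) t] = 0.
Proof.
move=> [_ [v E]] xt.
transitivity (F \mPo linear_map (perspectivity (point100 K) w)).@[affine_point x t].
  rewrite comp_mpoly_meval; apply: meval_eq => i; rewrite linear_map_perspectivity.
  rewrite mevalD mevalXU mevalZ raddf_sum /= !big_ord_recl big_ord0 !mevalZ !mevalXU.
  rewrite lift0_ord3 lift1_ord3 /affine_point !mxE.
  by case: (ord3P i) => -> /=; ring.
by rewrite E mevalM xt mulr0.
Qed.

Lemma stabilizer_point100_finite : finite_set (stabilizer F (point100 K)).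
Proof.
have [t [_ fin_t [x xt]]] := exists_finite_fiber (oner_neq0 _).
(* Taking X - t for [g] makes [s] different from [t]. *)
have [s [st fin_s [y ys]]] := exists_finite_fiber (negbT (polyXsubC_eq0 t)).
have dfact0 : 'X^(d`!) - 1 != 0 :> {poly K} by rewrite -size_poly_gt0 size_XnsubC ?fact_gt0.
(* [w] is determined by its multiplier, a root of unity of order dividing d!, and by the images of
   two points of the curve on the distinct lines Z = t Y and Z = s Y. These images stay in finite
   fibres. *)
pose f (w : 'rV[K]_3) := (1 + w 0 0, x + (w 0 0 * x + w 0 1 + w 0 2%:R * t),
  y + (w 0 0 * y + w 0 1 + w 0 2%:R * s)).
have f_inj : injective f.
  move=> w v [/addrI E0]; rewrite E0 -!addrA => /addrI/addrI Et /addrI/addrI Es.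
  have E2 : w 0 2%:R = v 0 2%:R.
    have ts : t - s != 0 by apply: contraNneq st => /eqP; rewrite root_XsubC subr_eq0 eq_sym.
    apply: (mulIf ts).
    transitivity ((w 0 1 + w 0 2%:R * t) - (w 0 1 + w 0 2%:R * s)); first by ring.
    by rewrite Et Es; ring.
  move: Et; rewrite E2 => /addIr E1.
  by apply/rowP => i; case: (ord3P i) => ->.
have := finite_setX (finite_setX (finite_root dfact0) fin_t) fin_s.
move/(finite_preimage (in2W f_inj)); apply: sub_finite_set => w sw.
split; [split|] => /=; [|exact: stabilizer_affine_point|exact: stabilizer_affine_point].
have := stabilizer_multiplier (point100_neq0 K) sw.
by rewrite multiplier_point100 /root !hornerE => ->; rewrite subrr.
Qed.

End Finiteness.

Lemma stabilizer_finite (K : closedFieldType) (F : {mpoly K[3]}) (d : nat)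
    (P : 'rV[K]_3) :
  (1 < d)%N -> F \is d.-homog -> irreducible_mpoly F -> P != 0 ->
  finite_set (stabilizer F P).
Proof.
move=> d_gt1 homF irrF P0; have [M uM PM] := exists_point100 P0.
have uM' : invmx M \in unitmx by rewrite unitmx_inv.
have := stabilizer_point100_finite d_gt1 (homog_comp_linear (invmx M) homF)
  (irreducible_comp_linear uM' irrF).
move/(finite_preimage (in2W (can_inj (mulmxKV uM)))); apply: sub_finite_set => w sw.
by rewrite -PM; apply: stabilizer_conj.
Qed.

(** * Cyclicity *)

Lemma natr_neq0_pchar (K : fieldType) (n : nat) : (0 < n)%N ->
  (forall p, p \in [pchar K] -> ~~ (p %| n)%N) -> n%:R != 0 :> K.
Proof.
move=> n0 np; apply/eqP => /eqP n00; have [p pK] := natf0_pchar n0 n00.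
by have := np p pK; rewrite (dvdn_pcharf pK) n00.
Qed.

(** Multiplication by an element z permutes the set; compare the products of all elements before and
    after. *)
Lemma unity_roots_of_mul_closed (K : fieldType) (rs : seq K) :
  uniq rs -> 0 \notin rs ->
  (forall x y, x \in rs -> y \in rs -> x * y \in rs) ->
  all (size rs).-unity_root rs.
Proof.
move=> urs rs0 rsM; apply/allP => z zrs; rewrite unity_rootE; apply/eqP.
have nz x : x \in rs -> x != 0 by apply: contraTneq => ->.
have sub : {subset map ( *%R z) rs <= rs}.
  by move=> _ /mapP[y yrs ->]; apply: rsM.
have uzrs : uniq (map ( *%R z) rs) by rewrite map_inj_uniq //; apply/mulfI/nz.
have [|_ eqz] := uniq_min_size uzrs sub; first by rewrite size_map.
have prod0 : \prod_(x <- rs) x != 0.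
  by rewrite prodf_seq_neq0; apply/allP => x /nz.
apply: (mulIf prod0); rewrite mul1r -[RHS](perm_big _ (uniq_perm uzrs urs eqz)) big_map.
by elim: (rs) => [|x s IHs]; rewrite ?big_nil ?mulr1 // !big_cons exprS -IHs /=; ring.
Qed.

Section Counting.
Variables (K : closedFieldType) (F : {mpoly K[3]}) (d : nat) (P : 'rV[K]_3).
Hypotheses (d_gt2 : (2 < d)%N) (homF : F \is d.-homog) (irrF : irreducible_mpoly F).
Hypothesis P_neq0 : P != 0.

Let F_neq0 : F != 0. Proof. by case: irrF. Qed.
Let finW : finite_set (stabilizer F P).
Proof. exact: stabilizer_finite (ltnW d_gt2) homF irrF P_neq0. Qed.

Let S := fset_set (stabilizer F P).
Let N := #|` S|.

Let in_S w : (w \in S) = (w \in stabilizer F P).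
Proof. exact: in_fset_set. Qed.

Let mem_S w : stabilizer F P w -> w \in S.
Proof. by rewrite in_S; exact: mem_set. Qed.

Let S_mem w : w \in S -> stabilizer F P w.
Proof. by rewrite in_S => /set_mem. Qed.

Lemma set_order_linear_projection_group : set_order (linear_projection_group F P) = N.
Proof.
(* [bir_one F] is a mere default: on the stabilizer a representative exists and is unique. *)
pose tau w : Bir F := xget (bir_one F) [set t | represented_by t (perspectivity P w)]%classic.
have tauP w : stabilizer F P w ->
    linear_projection_group F P (tau w) /\ represented_by (tau w) (perspectivity P w).
  move=> /(stabilizer_represented homF F_neq0)[t Gt tw].
  have tauw : represented_by (tau w) (perspectivity P w).
    by rewrite /tau; case: xgetP => [_ -> //|/(_ t)]; case.
  by rewrite (represented_by_inj tauw tw).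
have -> : linear_projection_group F P = (tau @` stabilizer F P)%classic.
  apply/seteqP; split=> [t /(linear_projection_group_stabilizer d_gt2 homF F_neq0 P_neq0)|].
    move=> [w sw tw]; exists w => //; have [_ tauw] := tauP w sw.
    exact: represented_by_inj tauw tw.
  by move=> _ [w sw <-]; case: (tauP w sw).
rewrite /set_order fset_set_image // card_in_imfset //.
move=> w v /S_mem/tauP[_ tw] /S_mem/tauP[_ tv] E.
by apply: (represented_by_perspectivity_inj d_gt2 homF F_neq0 P_neq0 tw); rewrite E.
Qed.

Lemma stabilizer_order_gt0 : (0 < N)%N.
Proof. by rewrite cardfs_gt0; apply/fset0Pn; exists 0; apply/mem_S/stabilizer0. Qed.

Hypothesis N_neq0 : N%:R != 0 :> K.

(* Translation by an elation w permutes the stabilizer, so that comparing the *)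
(* sums over the stabilizer yields N w = 0.                                   *)
Lemma stabilizer_elation w : stabilizer F P w -> multiplier P w = 1 -> w = 0.
Proof.
move=> sw w1; have := stabilizerV homF F_neq0 sw; rewrite w1 invr1 scaleN1r => sNw.
have Nw1 : multiplier P (- w) = 1.
  have := multiplierM P w (- w); rewrite w1 scale1r subrr multiplier0 mul1r.
  by move=> ->.
have perm : perm_eq (map (+%R w) S) S.
  have uS : uniq (map (+%R w) S) by rewrite map_inj_uniq; [exact: fset_uniq|exact: addrI].
  apply: uniq_perm uS (fset_uniq _) _ => v; apply/mapP/idP => [[u /S_mem su ->]|/S_mem sv].
    by apply: mem_S; rewrite -[u]scale1r -w1; apply: stabilizerM.
  exists (- w + v); last by rewrite addrA subrr add0r.
  by apply: mem_S; rewrite -[v]scale1r -Nw1; apply: stabilizerM.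
have := perm_big (op := +%R) (x := 0) (P := xpredT) (F := id) _ perm.
rewrite big_map big_split /= big_const_seq count_predT iter_addr_0 -/N.
rewrite -[RHS]add0r => /addIr/eqP; rewrite -scaler_nat scaler_eq0 (negPf N_neq0).
by move/eqP.
Qed.

(** With equal multipliers, [w] times the inverse of [v] is [w - v], an elation, hence 0. *)
Lemma multiplier_inj w v : stabilizer F P w -> stabilizer F P v ->
  multiplier P w = multiplier P v -> w = v.
Proof.
move=> sw sv wv; have [v0 _] := sv.
have := stabilizerM sw (stabilizerV homF F_neq0 sv).
rewrite wv scalerA mulrN divff // scaleN1r => swv.
apply/eqP; rewrite -subr_eq0; apply/eqP; apply: stabilizer_elation => //.
move: wv; rewrite /multiplier mulmxBl => /addrI.
by move: (w *m P^T) (v *m P^T) => x y; rewrite !mxE => ->; rewrite subrr addr0.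
Qed.

(** The multipliers are N distinct nonzero scalars closed under multiplication, hence all the N-th
    roots of unity. *)
Lemma multiplier_primitive_root : exists z, [/\ N.-primitive_root z,
  forall k, exists2 w, stabilizer F P w & multiplier P w = z ^+ k
  & forall w, stabilizer F P w -> exists k, multiplier P w = z ^+ k].
Proof.
pose rs := map (multiplier P) S.
have size_rs : size rs = N by rewrite size_map.
have urs : uniq rs.
  rewrite map_inj_in_uniq; first exact: fset_uniq.
  by move=> w v /S_mem sw /S_mem sv; apply: multiplier_inj.
have rs0 : 0 \notin rs.
  by apply/mapP => -[w /S_mem[w0 _] E]; rewrite -E eqxx in w0.
have rsM x y : x \in rs -> y \in rs -> x * y \in rs.
  move=> /mapP[w /S_mem sw ->] /mapP[v /S_mem sv ->].
  by rewrite -multiplierM; apply/map_f/mem_S/stabilizerM.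
have := unity_roots_of_mul_closed urs rs0 rsM; rewrite size_rs => unity.
have := has_prim_root stabilizer_order_gt0 unity urs.
rewrite size_rs leqnn => /(_ isT)/hasP[z zrs zP]; exists z.
have rsX k : z ^+ k \in rs.
  elim: k => [|k IHk]; last by rewrite exprS; apply: rsM.
  by rewrite expr0 -(multiplier0 P); apply/map_f/mem_S/stabilizer0.
split=> // [k|w sw]; first by have /mapP[w /S_mem sw E] := rsX k; exists w.
have wrs : multiplier P w \in rs by apply/map_f/mem_S.
have /eqP w1 : multiplier P w ^+ N == 1 by rewrite -unity_rootE (allP unity).
by have [i ->] := prim_rootP zP w1; exists i.
Qed.

End Counting.

(** An element whose multiplier is a primitive N-th root of unity generates, because an element is
    determined by its multiplier. *)
Lemma linear_projection_group_cyclic (K : closedFieldType) (F : {mpoly K[3]})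
    (d : nat) (P : 'rV[K]_3) :
  (2 < d)%N -> F \is d.-homog -> irreducible_mpoly F -> P != 0 ->
  (set_order (linear_projection_group F P))%:R != 0 :> K ->
  cyclic_subgroup (linear_projection_group F P).
Proof.
move=> d2 hF iF P0; rewrite (set_order_linear_projection_group d2 hF iF P0) => N0.
have F0 : F != 0 by case: iF.
have [z [zP zX Xz]] := multiplier_primitive_root d2 hF iF P0 N0.
have [w0 sw0 w0z] := zX 1%N; rewrite expr1 in w0z.
have [s Gs sw] := stabilizer_represented hF F0 sw0.
have pow k : exists w, [/\ stabilizer F P w, multiplier P w = z ^+ k
    & represented_by (s ^+ k)%g (perspectivity P w)].
  elim: k => [|k [w [sw' wz tw]]].
    exists 0; split; [exact: stabilizer0 | exact: multiplier0 |].
    by rewrite perspectivity0 expg0 /represented_by linear_map1; apply: bir_class_triple.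
  exists (w0 + multiplier P w0 *: w); split.
  - exact: stabilizerM.
  - by rewrite multiplierM w0z wz exprS.
  - by rewrite expgS -perspectivityM; apply: represented_by_mul.
have powG k : linear_projection_group F P (s ^+ k)%g.
  have [w [sw' _ tw]] := pow k.
  have [t Gt tw'] := stabilizer_represented hF F0 sw'.
  by rewrite (represented_by_inj tw tw').
have pow_eq j k : z ^+ j = z ^+ k -> (s ^+ j)%g = (s ^+ k)%g.
  have [[w [sw' wz tw]] [v [sv vz tv]]] := (pow j, pow k) => jk.
  have E : w = v by apply: (multiplier_inj d2 hF iF P0 N0 sw' sv); rewrite wz vz.
  by apply: (represented_by_inj tw); rewrite E.
exists s; apply/seteqP; split=> [t Gt|t [n [->|->]]] /=; last first.
- set N := #|` _| in zP.
  (* As s^N = 1, negative powers are also nonnegative ones. *)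
  have -> : (s ^- n)%g = (s ^+ (N * n - n))%g.
    rewrite expgnFr ?leq_pmull ?(prim_order_gt0 zP) //.
    have -> := pow_eq (N * n)%N 0%N; first by rewrite mul1g.
    by rewrite exprM (prim_expr_order zP) expr1n.
  exact: powG.
- exact: powG.
have [w sw' tw] := linear_projection_group_stabilizer d2 hF F0 P0 Gt.
have [k wz] := Xz _ sw'; exists k; left.
have [v [sv vz tv]] := pow k.
have E : w = v by apply: (multiplier_inj d2 hF iF P0 N0 sw' sv); rewrite wz vz.
by apply: (represented_by_inj tw); rewrite E.
Qed.

(** * The equation of the curve and the divisibility criterion *)

Lemma form_powers_X (K : fieldType) (F : {mpoly K[3]}) (d n : nat) :
  (0 < n)%N -> F \is d.-homog -> (forall m, m \in msupp F -> (n %| m 0%R)%N) ->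
  exists G : nat -> {mpoly K[2]}, (forall e, G e \is e.-homog) /\
    F = \sum_(i < d.+1 | (n * i <= d)%N) in_YZ (G (d - n * i)%N) * 'X_0 ^+ (n * i).
Proof.
move=> n0 hF div.
have deg m : m \in msupp F -> mdeg m = d by move/dhomogP: hF => /(_ m).
pose YZ (m : 'X_{1..3}) : 'X_{1..2} := [multinom m (lift 0%R i) | i < 2].
have degYZ m : mdeg m = (m 0%R + mdeg (YZ m))%N.
  rewrite !mdegE big_ord_recl; congr (_ + _)%N.
  by apply: eq_bigr => i _; rewrite mnmE.
have XYZ m : in_YZ 'X_[YZ m] * 'X_0 ^+ m 0 = 'X_[m] :> {mpoly K[3]}.
  rewrite /in_YZ comp_mpolyX [RHS]mpolyXE_id [RHS]big_ord_recl mulrC; congr (_ * _).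
  by apply: eq_bigr => i _; rewrite mnmE tnth_mktuple.
(* Monomials are sorted by their degree in Y and Z, so the index d - n i collects those containing X
   exactly to the power n i. *)
exists (fun e => \sum_(m <- msupp F | mdeg (YZ m) == e) F@_m *: 'X_[YZ m]); split.
  by move=> e; apply: rpred_sum => m me; apply: rpredZ; rewrite dhomogX.
rewrite {1}[F]mpolyE.
transitivity (\sum_(i < d.+1 | (n * i <= d)%N)
    \sum_(m <- msupp F | (m \in msupp F) && (m 0 == (n * i)%N)) F@_m *: 'X_[m]); last first.
  apply: eq_bigr => i ni; rewrite /in_YZ raddf_sum mulr_suml /= [RHS]big_seq_cond.
  apply: eq_big => [m|m /andP[mF /eqP m0]]; last by rewrite comp_mpolyZ -scalerAl -m0 XYZ.
  case mF: (m \in msupp F) => //=.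
  have := degYZ m; rewrite (deg _ mF) => E.
  apply/eqP/eqP => [m0|m0]; first by rewrite -(addKn (m 0%R) (mdeg _)) -E m0.
  by apply: (@addIn (d - n * i)%N); rewrite [RHS]subnKC // -m0 -E.
rewrite (exchange_big_dep (mem (msupp F))) /=; last by move=> i m _ /andP[].
rewrite [LHS]big_seq; apply: eq_bigr => m mF.
have m0d : (m 0%R <= d)%N by rewrite -(deg _ mF) degYZ leq_addr.
have /dvdnP[k mk] := div _ mF.
have kd : (k < d.+1)%N by rewrite ltnS (leq_trans _ m0d) // mk leq_pmulr.
rewrite (big_pred1 (Ordinal kd)) // => i /=.
rewrite mF /= mk [(k * n)%N]mulnC eqn_pmul2l // eq_sym -[RHS]val_eqE /=.
by rewrite andb_idl // => /eqP ->; rewrite mulnC -mk.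
Qed.

Theorem theorem3p5 (K : closedFieldType) (d : nat) (F : {mpoly K[3]})
    (P : 'rV[K]_3) :
  (4 <= d)%N ->
  F \is d.-homog ->
  irreducible_mpoly F ->
  P != 0 ->
  (forall p : nat, p \in [pchar K] ->
     ~~ (p %| set_order (linear_projection_group F P))%N) ->
  cyclic_subgroup (linear_projection_group F P) /\
  (forall n : nat, (2 <= n)%N ->
     (n %| set_order (linear_projection_group F P))%N <->
     exists M : 'M[K]_3,
       [/\ M \in unitmx,
           same_point (image_point M P) (point100 K),
           exists sigma : Bir (image_curve M F),
             linear_projection_group (image_curve M F) (image_point M P) sigma /\
             exists zeta : K, n.-primitive_root zeta /\
               represented_by sigma (diag_z11 zeta)
         & exists G : nat -> {mpoly K[2]},
             (forall e : nat, G e \is e.-homog) /\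
             image_curve M F =
               \sum_(i < d.+1 | (n * i <= d)%N)
                  in_YZ (G (d - n * i)%N) * 'X_0 ^+ (n * i)]).
Proof.
move=> d4 homF irrF P0 pN; have d2 : (2 < d)%N by apply: leq_trans d4.
have d1 : (1 < d)%N := ltnW d2; have [F0 _ _] := irrF.
have orderE := set_order_linear_projection_group d2 homF irrF P0.
have N0 : (set_order (linear_projection_group F P))%:R != 0 :> K.
  by apply: natr_neq0_pchar pN; rewrite orderE; apply: stabilizer_order_gt0 homF irrF P0.
split; first exact: linear_projection_group_cyclic homF irrF P0 N0.
move=> n n2; rewrite orderE in N0 *.
have [z [zP zX Xz]] := multiplier_primitive_root d2 homF irrF P0 N0.
split=> [nN|[M [uM [c c0 PM] [sigma [Gs [zeta [zetaP szeta]]]] _]]].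
(* [zeta] is z^(N / n). *)
- have zetaP := dvdn_prim_root zP nN; set zeta := z ^+ _ in zetaP.
  have [w sw wz] : exists2 w, stabilizer F P w & multiplier P w = zeta := zX _.
  have zeta1 : zeta != 1.
    by rewrite -[zeta]expr1 -(prim_order_dvd zetaP) dvdn1 neq_ltn n2 orbT.
  have [|M [uM PM wM]] := @diagonalize_perspectivity _ P w P0; first by rewrite wz.
  have homG := homog_comp_linear (invmx M) homF.
  have uM' : invmx M \in unitmx by rewrite unitmx_inv.
  have irrG := irreducible_comp_linear uM' irrF; have [G0 _ _] := irrG.
  have sM := stabilizer_conj uM sw.
  have diagE : perspectivity (image_point M P) (w *m invmx M) = diag_z11 zeta.
    rewrite PM wM wz -[point100 K in X in perspectivity X]scale1r diag_z11_perspectivity.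
    by rewrite mul1r addrC subrK.
  exists M; split=> //.
  + by exists 1; rewrite ?oner_neq0 // scale1r.
  + have [sigma Gs sw'] := stabilizer_represented homG G0 sM.
    by exists sigma; split=> //; exists zeta; split=> //; rewrite -diagE.
  apply: (form_powers_X (ltnW n2) homG).
  move=> m mG; rewrite (prim_order_dvd zetaP); apply/eqP.
  apply: (stabilized_diag d1 homG irrG _ mG); rewrite -diagE.
  by case: sM.
have homG := homog_comp_linear (invmx M) homF.
have zeta0 : zeta != 0.
  apply/eqP => z0; have /eqP := prim_expr_order zetaP.
  by rewrite z0 expr0n gtn_eqF ?(ltnW n2) // eq_sym oner_eq0.
(* [image_point M P] is only a multiple c (1, 0, 0) of the standard vector, hence the factor
   [c^-1]. *)
have diagE : perspectivity (image_point M P) (c^-1 * (zeta - 1) *: point100 K) = diag_z11 zeta.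
  by rewrite PM diag_z11_perspectivity mulrA divff // mul1r addrC subrK.
have := represented_by_dvdF homG szeta; rewrite -diagE => Gzeta.
have sG : stabilizer (image_curve M F) (image_point M P) (c^-1 * (zeta - 1) *: point100 K).
  split=> //; apply: multiplier_neq0; rewrite diagE unitmxE det_diag unitfE.
  by apply/prodf_neq0 => i _; rewrite mxE; case: ifP; rewrite ?oner_neq0.
have sF := stabilizer_conjV uM sG; have [k Ek] := Xz _ sF.
have Ez : multiplier P (c^-1 * (zeta - 1) *: point100 K *m M) = zeta.
  rewrite -(multiplier_conj _ _ uM) mulmxK // -/(image_point M P) PM /multiplier.
  rewrite linearZ /= -scalemxAl -scalemxAr scalerA /point100 trmx_delta mul_delta_mx.
  by rewrite !mxE mulr1 mulrAC mulVf // mul1r addrC subrK.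
(* Being a multiplier for [F], [zeta] is a power of z, so zeta^N = 1 and its order n divides N. *)
rewrite (prim_order_dvd zetaP) -{1}Ez Ek -exprM mulnC exprM (prim_expr_order zP).
by rewrite expr1n.
Qed.
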